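(* Let $f_0$ be a degenerate point with multiplicity $r\geq 2$, where the indices are ordered so that $(F_0)_{ii}=f_0$ for $i=1,\dots,r$. Then $F_\varepsilon$ has associated eigenvalues given by $$f_0+\varepsilon f_i+O(\varepsilon^2)\quad (\varepsilon\to 0),$$ where $f_i$, for $i=1,\dots,r$, are the eigenvalues of the $r\times r$ upper-left block of $F_1$, whose entries are given by $$(F_1)_{lk}=\left(A_1^{(m_l-m_k)}\right)_{lk}\quad\text{for } l,k=1,\dots,r,$$ where $m_l$ and $m_k$ denote the folding numbers of the $l$-th and $k$-th eigenvalues (diagonal entries) of $A_0$.
   Context: Let $T>0$, $\Omega=2\pi/T$, and consider the system of ODEs $\frac{\mathrm{d}y}{\mathrm{d}t}(t)=A_\varepsilon(t)y(t)$, where the $N\times N$ complex matrix $A_\varepsilon(t)$ is continuous and $T$-periodic in $t$ and has the expansion $A_\varepsilon(t)=A_0+\varepsilon A_1(t)+\varepsilon^2A_2(t)+\cdots$, convergent for $|\varepsilon|<r_0$ with $r_0>0$ independent of $t$. Assume $A_0$ is constant in time and diagonal. Write $A_1(t)=\sum_{m\in\mathbb{Z}}e^{\mathrm{i}\Omega mt}A_1^{(m)}$ for the Fourier series of $A_1$. Folding numbers: the imaginary part of the $k$-th diagonal entry of $A_0$ is written uniquely as $\omega_0+m_k\Omega$ with $\omega_0\in[-\Omega/2,\Omega/2)$ and $m_k\in\mathbb{Z}$; $m_k$ is the folding number of $(A_0)_{kk}$. Floquet matrix: the fundamental solution $X_\varepsilon$ with $X_\varepsilon(0)=\mathrm{Id}$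 is written (Floquet's theorem) as $X_\varepsilon(t)=P_\varepsilon(t)e^{F_\varepsilon t}$, with $P_\varepsilon$ $T$-periodic, $P_\varepsilon(0)=\mathrm{Id}$, $F_\varepsilon$ constant in $t$. The matrix $F_0$ is chosen with imaginary parts of its eigenvalues in $[-\Omega/2,\Omega/2)$, namely $F_0=A_0-\mathrm{i}\Omega\,\mathrm{diag}(m_1,\dots,m_N)$; in particular $F_0$ has no distinct eigenvalues congruent modulo $2\pi\mathrm{i}/T$. Under these assumptions $P_\varepsilon$ and $F_\varepsilon$ are analytic in $\varepsilon$ at $\varepsilon=0$: $P_\varepsilon(t)=P_0(t)+\varepsilon P_1(t)+\cdots$ and $F_\varepsilon=F_0+\varepsilon F_1+\varepsilon^2F_2+\cdots$. A degenerate point is an eigenvalue $f_0$ of $F_0$ of multiplicity $r\geq2$.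
   Formalization: The O(ε²) remainder is proved only when f_i is a semisimple eigenvalue of the block; otherwise o(ε), since O(ε²) fails for A_ε=[[0,ε],[ε²,0]] (eigenvalues ±ε^{3/2}). The expansion of A_ε is read as converging uniformly in t. *)

(* Defs.v *)
From HB Require Import structures.
From mathcomp Require Import all_boot all_order all_algebra.
From mathcomp Require Import complex.
From mathcomp Require Import all_classical all_reals all_analysis.

Set Implicit Arguments.
Unset Strict Implicit.
Unset Printing Implicit Defensive.

Import Order.TTheory GRing.Theory Num.Theory.
Import numFieldTopology.Exports numFieldNormedType.Exports.

Local Open Scope classical_set_scope.
Local Open Scope ring_scope.
Local Open Scope complex_scope.

(* MathComp-Analysis puts a topology on abstract numClosedFieldTypes only; this
   transfers it, with the norm |z| as a complex number, to the concrete R[i]. *)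
#[export, non_forgetful_inheritance]
HB.instance Definition _ (R : realType) :=
  PseudoPointedMetric.copy R[i] (R[i])^o.
#[export, non_forgetful_inheritance]
HB.instance Definition _ (R : realType) := NormedModule.copy R[i] (R[i])^o.

Definition expi (R : realType) (x : R) : R[i] := cos x +i* sin x.

Definition is_cderive (R : realType) (y : R -> R[i]) (t : R) (dy : R[i]) : Prop :=
  is_derive t (1 : R) (fun u => complex.Re (y u)) (complex.Re dy) /\
  is_derive t (1 : R) (fun u => complex.Im (y u)) (complex.Im dy).

Definition cintegral (R : realType) (a b : R) (g : R -> R[i]) : R[i] :=
  (\int[lebesgue_measure]_(x in `[a, b]) complex.Re (g x))%R +i*
  (\int[lebesgue_measure]_(x in `[a, b]) complex.Im (g x))%R.

Definition angular_freq (R : realType) (T : R) : R := 2 * pi / T.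

Definition fourier_mx (R : realType) (N : nat) (T : R) (B : R -> 'M[R[i]]_N)
    (m : int) : 'M[R[i]]_N :=
  \matrix_(i, j) ((T^-1)%:C *
    cintegral 0 T (fun t => expi (- (angular_freq T * m%:~R * t)) * B t i j)).

Definition expmx (R : realType) (N : nat) (M : 'M[R[i]]_N) : 'M[R[i]]_N :=
  lim (series (fun k => (k`!%:R : R[i])^-1 *: M ^+ k) @ \oo).

Definition power_series (K : numFieldType) (V : lmodType K) (a : nat -> V) (e : K) :
  nat -> V := series (fun n => e ^+ n *: a n).

(* Uniform convergence in t renders "radius of convergence independent of t":
   the expansion is one in the Banach space of continuous T-periodic matrix
   functions. *)
Definition periodic_expansion (R : realType) (N : nat) (T r0 : R)
    (A : R[i] -> R -> 'M[R[i]]_N) (A_ : nat -> R -> 'M[R[i]]_N) : Prop :=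
  [/\ (forall e : R[i], `|e| < r0%:C -> continuous (A e) /\ periodic (A e) T),
      (forall n, continuous (A_ n) /\ periodic (A_ n) T) &
      (forall e : R[i], `|e| < r0%:C ->
         {uniform, (fun n t => power_series (A_ ^~ t) e n) @ \oo --> A e})].

Definition is_folding_number (R : realType) (T : R) (a : R[i]) (m : int) : Prop :=
  - (angular_freq T / 2) <= complex.Im a - m%:~R * angular_freq T
    < angular_freq T / 2.

Definition fundamental_solution (R : realType) (N : nat)
    (A X : R -> 'M[R[i]]_N) : Prop :=
  X 0 = 1%:M /\
  forall t i j, is_cderive (fun u => X u i j) t ((A t *m X t) i j).

Definition floquet_decomposition (R : realType) (N : nat) (T : R)
    (X P : R -> 'M[R[i]]_N) (F : 'M[R[i]]_N) : Prop :=
  [/\ periodic P T, P 0 = 1%:M & forall t, X t = P t *m expmx (t%:C *: F)].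

Definition analytic_at0 (R : realType) (N : nat) (F : R[i] -> 'M[R[i]]_N)
    (F_ : nat -> 'M[R[i]]_N) : Prop :=
  \forall e \near (0 : R[i]), power_series F_ e @ \oo --> F e.

(* [mup] is the algebraic multiplicity, as a root of the characteristic
   polynomial. *)
Definition degenerate_point (K : fieldType) (N : nat) (F0 : 'M[K]_N) (f0 : K)
    (r : nat) : Prop :=
  (2 <= r)%N /\ mup f0 (char_poly F0) = r.

(* All eigenvalues, repeated according to algebraic multiplicity. *)
Definition eigenvalue_list (K : fieldType) (N : nat) (B : 'M[K]_N) (f : 'I_N -> K)
  : Prop := char_poly B = \prod_(i < N) ('X - (f i)%:P).

(* The O(e^2) remainder needs this: for N = 2, A_0 = 0, A_1 = [0 1; 0 0],
   A_2 = [0 0; 1 0] constant in time, F(e) = e A_1 + e^2 A_2 has the eigenvalues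
   +- e^(3/2), which are o(e) but not O(e^2). *)
Definition semisimple_eigenvalue (K : fieldType) (N : nat) (B : 'M[K]_N) (a : K)
  : Prop := \rank (eigenspace B a) = mup a (char_poly B).

(* Main.v *)
Require Import Defs.
From HB Require Import structures.
From mathcomp Require Import all_boot all_order all_algebra.
From mathcomp Require Import complex.
From mathcomp Require Import all_classical all_reals all_analysis.
From mathcomp Require Import ring lra.

Set Implicit Arguments.
Unset Strict Implicit.
Unset Printing Implicit Defensive.

Import Order.TTheory GRing.Theory Num.Theory.
Import numFieldTopology.Exports numFieldNormedType.Exports.

Local Open Scope classical_set_scope.
Local Open Scope ring_scope.
Local Open Scope complex_scope.

(** The monodromy matrix X_e(T) = exp(T F(e)) is expanded to first order in e in two
    ways, by Duhamel's formula for y' = A_e(t) y and for y' = F(e) y. Both systems have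
    a diagonal unperturbed part, so the (l, k) entries are weighted integrals of A_1 and
    of F_1; when F_0 has equal l-th and k-th diagonal entries the second weight is
    constant and the first is a pure exponential of frequency m_k - m_l, which gives
    the Fourier coefficient.

    For the eigenvalues, put x = f0 + e w and divide the first r rows of x - F(e) by e:
    the determinant converges to det(w - F_1') det(f0 - F_0''), with F_1' the upper-left
    block of F_1 and F_0'' the lower-right block of F_0. Hence the rescaled roots w
    converge to the eigenvalues of F_1', up to a matching of the roots. If the
    eigenvalue a of B + a = F_1' is semisimple then B = B^2 L for some L, and eliminating
    the lower block of an eigenvector leaves u (B - (w - a)) = O(e) u; multiplying by
    1 - B L, which B annihilates, bounds w - a by O(e). *)

(** The eigenvalues of F(e) come without a labelling, and an individual eigenvalue has no evident
    regularity in e; only determinants, hence products over all roots, are visibly continuous.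
    Limits are therefore proved for root products, and a labelling is extracted afterwards. The
    rescaled determinant still contains the s roots that stay away from f0, so an unscaled labelling
    comes first: it identifies these roots, and their product, with its nonzero limit, is divided
    out. Convergence of determinants gives no rate, and thus only f0 + e f_i + o(e). The rate in the
    semisimple case comes from a separate eigenvector estimate, for which the limit already obtained
    supplies the smallness. On the Floquet side the first-order coefficients are compared after
    division by e. This requires both remainders to be O(e^2) with constants uniform on [0, T]; they
    come from Cauchy estimates on the coefficients. *)

(** * Characteristic polynomials and semisimple eigenvalues *)

Lemma char_poly_mulmxC (K : comNzRingType) m n (B : 'M[K]_(m, n)) (C : 'M[K]_(n, m)) :
  'X^n * char_poly (B *m C) = 'X^m * char_poly (C *m B).
Proof.
rewrite /char_poly /char_poly_mx !map_mxM /=.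
set b := map_mx polyC B; set c := map_mx polyC C.
(* [M] is reduced in two ways. Clearing [c] from the right leaves the Schur complement X - bc;
   multiplying from the left by a matrix of determinant X^n leaves X - cb. *)
pose M := block_mx ('X%:M : 'M[{poly K}]_m) b c (1%:M : 'M[{poly K}]_n).
have detM : \det M = \det ('X%:M - b *m c).
  have : M *m block_mx 1%:M 0 (- c) 1%:M = block_mx ('X%:M - b *m c) b 0 1%:M.
    rewrite mulmx_block !mulmx1 !mulmx0 !add0r mulmxN mul1mx.
    by rewrite subrr.
  move/(congr1 determinant); rewrite det_mulmx det_lblock det_ublock !det1.
  by rewrite !mulr1.
have : block_mx 1%:M 0 (- c) ('X%:M : 'M[{poly K}]_n) *m M =
    block_mx 'X%:M b 0 ('X%:M - c *m b).
  rewrite mulmx_block !mul1mx !mul0mx !addr0 mulmx1 mulNmx mulNmx.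
  rewrite (scalar_mxC 'X c) addNr.
  by congr block_mx; rewrite addrC.
move/(congr1 determinant); rewrite det_mulmx det_lblock det_ublock det1 mul1r.
by rewrite !det_scalar detM.
Qed.

Lemma char_poly_subscalar (K : comNzRingType) n (B : 'M[K]_n) (a : K) :
  char_poly (B - a%:M) = char_poly B \Po ('X + a%:P).
Proof.
rewrite /char_poly -(det_map_mx (comp_poly ('X + a%:P))); congr determinant.
apply/matrixP => i j; rewrite !mxE /= polyCB comp_polyB comp_polyC.
case: (i == j); rewrite ?mulr1n ?mulr0n ?polyC0 ?comp_polyX ?comp_poly0.
  by rewrite opprB addrA.
by rewrite subr0.
Qed.

(* In a rank factorisation [B - a = C D], Sylvester's identity [char_poly_mulmxC]
   makes [D C] invertible, and [L = C (D C)^-2 D] works. *)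
Lemma semisimple_pinv (K : fieldType) n (B : 'M[K]_n) (a : K) :
  semisimple_eigenvalue B a ->
  exists L : 'M[K]_n, (B - a%:M) *m (1%:M - (B - a%:M) *m L) = 0.
Proof.
move=> ss; set M := B - a%:M.
set C := col_base M; set D := row_base M; set E := D *m C.
have ME : M = C *m D by rewrite mulmx_base.
(* Semisimplicity equates the kernel dimension n - rank M with the multiplicity of [a]; after the
   shift by [a], exactly this power of X splits off. *)
have [p p0 pE] : exists2 p, p.[0] != 0 & char_poly M = 'X^(n - \rank M) * p.
  have := ss; rewrite /semisimple_eigenvalue /eigenspace mxrank_ker -/M => ->.
  have cp0 : char_poly B != 0 by rewrite monic_neq0 ?char_poly_monic.
  have [m [q]] := multiplicity_XsubC (char_poly B) a; rewrite cp0 /= => qa qE.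
  exists (q \Po ('X + a%:P)).
    by move: qa; rewrite horner_comp !hornerE.
  rewrite char_poly_subscalar qE mupMr // mup_XsubCX eqxx.
  by rewrite rmorphM rmorphXn rmorphB /= comp_polyX comp_polyC addrK mulrC.
(* In Sylvester's identity X^n cancels, so [p] is the characteristic polynomial of [E] and p(0) is
   det E up to sign. *)
have Eu : E \in unitmx.
  have := char_poly_mulmxC C D; rewrite -ME -/E pE mulrA -exprD.
  rewrite subnKC ?rank_leq_row // => /mulfI.
  rewrite expf_neq0 ?polyX_eq0 // => /(_ isT) /(congr1 (horner^~ 0)).
  move=> /= pE0; move: p0; rewrite pE0 horner_coef0 char_poly_det.
  by rewrite mulf_eq0 signr_eq0 /= => E0; rewrite unitmxE unitfE.
exists (C *m invmx E *m invmx E *m D).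
move: Eu; rewrite /E; move: (C) (D) ME; move: (\rank M) => k C' D' -> Eu.
rewrite mulmxBr mulmx1; apply/eqP; rewrite subr_eq0; apply/eqP.
rewrite !mulmxA -(mulmxA C' D' C') -(mulmxA (C' *m (D' *m C')) D' C').
by rewrite mulmxK // mulmxK.
Qed.

(** * Real-valued norms of complex numbers and matrices *)

Local Notation normc := ComplexField.Normc.normc.

Section complex_norm.
Variable R : rcfType.
Implicit Types x y z : R[i].

Lemma normc_ge0 z : 0 <= normc z.
Proof. by case: z => a b /=; exact: sqrtr_ge0. Qed.

Lemma normc0 : normc (0 : R[i]) = 0.
Proof. exact: ComplexField.Normc.normc0. Qed.

Lemma normc1 : normc (1 : R[i]) = 1.
Proof. exact: ComplexField.Normc.normc1. Qed.

Lemma normcM x y : normc (x * y) = normc x * normc y.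
Proof. exact: ComplexField.Normc.normcM. Qed.

Lemma normcV x : normc x^-1 = (normc x)^-1.
Proof. exact: ComplexField.Normc.normcV. Qed.

Lemma ler_normcD x y : normc (x + y) <= normc x + normc y.
Proof. exact: le_normcD. Qed.

Lemma normcN x : normc (- x) = normc x.
Proof. exact: complex.normcN. Qed.

Lemma normcB x y : normc (x - y) = normc (y - x).
Proof. by rewrite -normcN opprB. Qed.

Lemma normc_eq0 x : (normc x == 0) = (x == 0).
Proof.
by apply/eqP/eqP => [/ComplexField.Normc.eq0_normc//|->]; exact: normc0.
Qed.

Lemma normc_gt0 x : (0 < normc x) = (x != 0).
Proof. by rewrite lt_def normc_ge0 andbT normc_eq0. Qed.

Lemma normcX x n : normc (x ^+ n) = normc x ^+ n.
Proof. by elim: n => [|n IH]; rewrite ?expr0 ?normc1// !exprS normcM IH. Qed.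

Lemma normc_real (a : R) : normc a%:C = `|a|.
Proof. by rewrite /= expr0n addr0 sqrtr_sqr. Qed.

Lemma ler_normc_sum I (r : seq I) (P : pred I) (F : I -> R[i]) :
  normc (\sum_(i <- r | P i) F i) <= \sum_(i <- r | P i) normc (F i).
Proof.
elim/big_ind2 : _ => [|a b c d ab cd|//]; first by rewrite normc0.
by rewrite (le_trans (ler_normcD _ _))// lerD.
Qed.

Lemma normc_prod I (r : seq I) (P : pred I) (F : I -> R[i]) :
  normc (\prod_(i <- r | P i) F i) = \prod_(i <- r | P i) normc (F i).
Proof. by rewrite (big_morph _ normcM normc1). Qed.

Lemma ler_Re_normc z : `|complex.Re z| <= normc z.
Proof. by case: z => a b /=; rewrite -sqrtr_sqr; apply: ler_wsqrtr; rewrite lerDl sqr_ge0. Qed.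

Lemma ler_Im_normc z : `|complex.Im z| <= normc z.
Proof. by case: z => a b /=; rewrite -sqrtr_sqr; apply: ler_wsqrtr; rewrite lerDr sqr_ge0. Qed.

Lemma ler_normc_ReIm z : normc z <= `|complex.Re z| + `|complex.Im z|.
Proof.
case: z => a b /=; rewrite -[leRHS]ger0_norm ?addr_ge0// -[leRHS]sqrtr_sqr.
apply: ler_wsqrtr.
rewrite sqrrD -!normrX !(ger0_norm (sqr_ge0 _)) lerD2r lerDl.
by rewrite mulrn_wge0// mulr_ge0.
Qed.

Lemma ler_distc x y : normc x - normc y <= normc (x - y).
Proof. by rewrite lerBlDr (le_trans _ (ler_normcD _ _))// subrK. Qed.

(** The entrywise l^1 norm: submultiplicative for rectangular factors and additive over blocks,
    which suits block elimination. *)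
Definition mxn m n (A : 'M[R[i]]_(m, n)) : R := \sum_i \sum_j normc (A i j).

Lemma mxn_ge0 m n (A : 'M[R[i]]_(m, n)) : 0 <= mxn A.
Proof. by apply: sumr_ge0 => i _; apply: sumr_ge0 => j _; exact: normc_ge0. Qed.

Lemma ler_entry_mxn m n (A : 'M[R[i]]_(m, n)) i j : normc (A i j) <= mxn A.
Proof.
rewrite /mxn (bigD1 i)//= (bigD1 j)//= -addrA lerDl addr_ge0//.
  by apply: sumr_ge0 => ? _; exact: normc_ge0.
by apply: sumr_ge0 => ? _; apply: sumr_ge0 => ? _; exact: normc_ge0.
Qed.

Lemma ler_row_mxn m n (A : 'M[R[i]]_(m, n)) i : \sum_j normc (A i j) <= mxn A.
Proof.
rewrite /mxn [leRHS](bigD1 i)//= lerDl.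
by apply: sumr_ge0 => ? _; apply: sumr_ge0 => ? _; exact: normc_ge0.
Qed.

Lemma mxn_eq0 m n (A : 'M[R[i]]_(m, n)) : mxn A = 0 -> A = 0.
Proof.
move=> A0; apply/matrixP => i j; rewrite mxE; apply/eqP.
by rewrite -normc_eq0 eq_le normc_ge0 andbT -A0 ler_entry_mxn.
Qed.

Lemma mxnN m n (A : 'M[R[i]]_(m, n)) : mxn (- A) = mxn A.
Proof.
by apply: eq_bigr => i _; apply: eq_bigr => j _; rewrite mxE normcN.
Qed.

Lemma mxnZ m n (a : R[i]) (A : 'M[R[i]]_(m, n)) : mxn (a *: A) = normc a * mxn A.
Proof.
rewrite /mxn mulr_sumr; apply: eq_bigr => i _.
by rewrite mulr_sumr; apply: eq_bigr => j _; rewrite mxE normcM.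
Qed.

Lemma ler_mxnD m n (A B : 'M[R[i]]_(m, n)) : mxn (A + B) <= mxn A + mxn B.
Proof.
rewrite /mxn -big_split ler_sum// => i _.
by rewrite -big_split ler_sum// => j _; rewrite mxE ler_normcD.
Qed.

Lemma ler_mxnM m n p (A : 'M[R[i]]_(m, n)) (B : 'M[R[i]]_(n, p)) :
  mxn (A *m B) <= mxn A * mxn B.
Proof.
rewrite {1 2}/mxn mulr_suml ler_sum// => i _.
rewrite (le_trans (ler_sum _ (fun j _ => _ : _ <= \sum_k normc (A i k) * normc (B k j))))//.
  by move=> j _; rewrite mxE (le_trans (ler_normc_sum _ _ _))// ler_sum// => k _; rewrite normcM.
rewrite exchange_big /= mulr_suml ler_sum// => k _.
by rewrite -mulr_sumr ler_wpM2l ?normc_ge0// ler_row_mxn.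
Qed.

End complex_norm.

(** * Limits of complex-valued functions along a filter *)

Section clim.
Variables (R : realType) (T : Type) (F : set_system T).
Context {FF : Filter F}.
Implicit Types (f g : T -> R[i]) (a b : R[i]).

(** Tolerances are real, whereas the built-in norm of [R[i]] has values in [R[i]]; [clim_cvgP]
    identifies this with filter convergence. *)
Definition clim f a :=
  forall eps : R, 0 < eps -> \forall x \near F, normc (f x - a) < eps.

Lemma clim_near f g a : (\forall x \near F, f x = g x) -> clim f a -> clim g a.
Proof.
by move=> fg fa e e0; near=> x; rewrite -(near fg x)//; near: x; exact: fa.
Unshelve. all: by end_near. Qed.

Lemma clim_cst a : clim (fun=> a) a.
Proof. by move=> e e0; near=> x; rewrite subrr normc0. Unshelve. all: by end_near. Qed.

Lemma climD f g a b : clim f a -> clim g b -> clim (fun x => f x + g x) (a + b).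
Proof.
move=> fa gb e e0; near=> x.
rewrite opprD addrACA (le_lt_trans (ler_normcD _ _))// [e]splitr ltrD//.
  by near: x; apply: fa; rewrite divr_gt0.
by near: x; apply: gb; rewrite divr_gt0.
Unshelve. all: by end_near. Qed.

Lemma climM f g a b : clim f a -> clim g b -> clim (fun x => f x * g x) (a * b).
Proof.
move=> fa gb e e0; set K := 1 + normc a + normc b.
have K0 : 0 < K by rewrite /K -addrA ltr_pwDl// addr_ge0// normc_ge0.
(* With both errors below d <= 1, the three terms of the expanded difference are at most d, d |b|
   and |a| d, in total d K. *)
pose d := Num.min 1 (e / K).
have d0 : 0 < d by rewrite lt_min ltr01 divr_gt0.
near=> x.
have fx : normc (f x - a) < d by near: x; exact: fa.
have gx : normc (g x - b) < d by near: x; exact: gb.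
have -> : f x * g x - a * b = (f x - a) * (g x - b) + (f x - a) * b + a * (g x - b).
  by rewrite -mulrDr subrK mulrBl mulrBr addrA subrK.
have dK : d * K <= e by rewrite -ler_pdivlMr// ge_min lexx orbT.
apply: lt_le_trans dK.
have d1 : d <= 1 by rewrite ge_min lexx.
have pq : normc (f x - a) * normc (g x - b) <= normc (f x - a).
  by rewrite ler_piMr ?normc_ge0// (le_trans (ltW gx)).
have pB : normc (f x - a) * normc b <= d * normc b.
  by rewrite ler_wpM2r ?normc_ge0// ltW.
have Aq : normc a * normc (g x - b) <= normc a * d.
  by rewrite ler_wpM2l ?normc_ge0// ltW.
have := ler_normcD ((f x - a) * (g x - b) + (f x - a) * b) (a * (g x - b)).
have := ler_normcD ((f x - a) * (g x - b)) ((f x - a) * b).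
rewrite !normcM /K !mulrDr mulr1 (mulrC d (normc a)); lra.
Unshelve. all: by end_near. Qed.

Lemma climN f a : clim f a -> clim (fun x => - f x) (- a).
Proof. by move=> fa e /fa; apply: filterS => x; rewrite -opprD normcN. Qed.

Lemma climB f g a b : clim f a -> clim g b -> clim (fun x => f x - g x) (a - b).
Proof. by move=> fa gb; apply: climD => //; exact: climN. Qed.

Lemma climV f a : a != 0 -> clim f a -> clim (fun x => (f x)^-1) a^-1.
Proof.
move=> a0 fa e e0; have na0 : 0 < normc a by rewrite normc_gt0.
(* The first bound keeps |f x| above |a| / 2, hence the denominator |f x a| above |a|^2 / 2; the
   second then makes the quotient less than [e]. *)
pose d := Num.min (normc a / 2) (e * (normc a ^+ 2 / 2)).
have d0 : 0 < d by rewrite lt_min !(divr_gt0, mulr_gt0, exprn_gt0)//.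
near=> x.
have fx : normc (f x - a) < d by near: x; exact: fa.
have fx2 : normc a / 2 < normc (f x).
  have d1 : d <= normc a / 2 by rewrite ge_min lexx.
  have := ler_distc a (f x); rewrite normcB; lra.
have nf0 : 0 < normc (f x) by rewrite (lt_trans _ fx2)// divr_gt0.
have f0 : f x != 0 by rewrite -normc_gt0.
have -> : (f x)^-1 - a^-1 = - ((f x - a) / (f x * a)) by field; rewrite f0 a0.
rewrite normcN normcM normcV normcM ltr_pdivrMr ?mulr_gt0//.
have d2 : d <= e * (normc a ^+ 2 / 2) by rewrite ge_min lexx orbT.
apply: (lt_le_trans fx); apply: (le_trans d2); rewrite ler_pM2l//.
by rewrite expr2 mulrAC ler_pM2r// ltW.
Unshelve. all: by end_near. Qed.

Lemma clim_sum I (r : seq I) (P : pred I) (f : I -> T -> R[i]) (a : I -> R[i]) :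
  (forall i, P i -> clim (f i) (a i)) ->
  clim (fun x => \sum_(i <- r | P i) f i x) (\sum_(i <- r | P i) a i).
Proof.
move=> fa; elim: r => [|i r IH].
  by rewrite big_nil; under eq_fun do rewrite big_nil; exact: clim_cst.
rewrite big_cons; under eq_fun do rewrite big_cons.
by case: ifP => // Pi; apply: climD => //; exact: fa.
Qed.

Lemma clim_prod I (r : seq I) (P : pred I) (f : I -> T -> R[i]) (a : I -> R[i]) :
  (forall i, P i -> clim (f i) (a i)) ->
  clim (fun x => \prod_(i <- r | P i) f i x) (\prod_(i <- r | P i) a i).
Proof.
move=> fa; elim: r => [|i r IH].
  by rewrite big_nil; under eq_fun do rewrite big_nil; exact: clim_cst.
rewrite big_cons; under eq_fun do rewrite big_cons.
by case: ifP => // Pi; apply: climM => //; exact: fa.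
Qed.

Lemma clim_det n (A : T -> 'M[R[i]]_n) (B : 'M[R[i]]_n) :
  (forall i j, clim (fun x => A x i j) (B i j)) ->
  clim (fun x => \det (A x)) (\det B).
Proof.
move=> AB; apply: clim_sum => s _; apply: climM; first exact: clim_cst.
by apply: clim_prod => i _; exact: AB.
Qed.

End clim.

(** * Convergence of roots from convergence of root products *)

(** Pigeonhole: the points a + d / (k + 1), k = 0, ..., [size S], are distinct and one more than the
    elements of [S]. *)
Lemma notin_near (R : realType) (S : seq R[i]) (a : R[i]) (d : R) : 0 < d ->
  exists2 x, x \notin S & normc (x - a) <= d.
Proof.
move=> d0; pose s := [seq a + (d / k.+1%:R)%:C | k <- iota 0 (size S).+1].
have us : uniq s.
  rewrite map_inj_uniq ?iota_uniq// => j k /addrI [].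
  move/(mulfI (lt0r_neq0 d0))/invr_inj => /eqP.
  by rewrite eqr_nat eqSS => /eqP.
have /allPn[x /mapP[k _ ->] xS] : ~~ all (mem S) s.
  apply/negP => /allP sS; have := uniq_leq_size us sS.
  by rewrite size_map size_iota ltnn.
exists (a + (d / k.+1%:R)%:C) => //.
rewrite addrAC subrr add0r normc_real ger0_norm; last by rewrite divr_ge0 ?ltW.
by rewrite ler_pdivrMr// ler_peMr ?(ltW d0)// ler1n.
Qed.

Lemma seq_argmin (R : realDomainType) (I : eqType) (g : I -> R) (s : seq I) : s != [::] ->
  exists2 w, w \in s & forall v, v \in s -> g w <= g v.
Proof.
elim: s => [//|a [|b s] IH] _.
  by exists a; rewrite ?mem_head// => v; rewrite inE => /eqP ->.
have [//|w ws wm] := IH; have [aw|wa] := leP (g a) (g w).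
  exists a; first exact: mem_head.
  by move=> v; rewrite inE => /predU1P[->//|/wm]; exact: le_trans.
exists w; first by rewrite inE ws orbT.
by move=> v; rewrite inE => /predU1P[->|/wm//]; exact: ltW.
Qed.

(* The product convergence is only required off a finite set, so that a pair of
   matched roots can be divided out. *)
Lemma match_roots (R : realType) (T : Type) (F : set_system T) {FF : Filter F}
    (S f : seq R[i]) (z : T -> seq R[i]) :
  (forall e, size (z e) = size f) ->
  (forall x, x \notin S -> clim F (fun e => \prod_(w <- z e) (x - w))
     (\prod_(w <- f) (x - w))) ->
  exists z' : T -> seq R[i], (forall e, perm_eq (z' e) (z e)) /\
    forall i, (i < size f)%N -> clim F (fun e => (z' e)`_i) f`_i.
Proof.
elim: f S z => [|a f IH] S z sz zf; first by exists z.
(* [w e] is a root closest to the head [a]; it is matched with [a], and the induction runs on the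
   remaining roots. *)
have /choice[w wP] : forall e, exists w, w \in z e /\
    forall v, v \in z e -> normc (a - w) <= normc (a - v).
  move=> e; have /(seq_argmin (fun v => normc (a - v)))[w] : z e != [::].
    by rewrite -size_eq0 sz.
  by exists w.
(* Take x outside [S] within d of [a]. The limit product at x is at most d C, so the product over
   [z e] is eventually below d (C + 1) <= eta^(size f + 1), and one of its size f + 1 factors is
   below eta. The corresponding root lies within 2 eta = eps of [a], hence so does the closest
   one. *)
have wa : clim F w a.
  move=> eps eps0; set eta := eps / 2; have eta0 : 0 < eta by rewrite divr_gt0.
  pose C := \prod_(v <- f) (1 + normc (a - v)).
  have C0 : 0 <= C by apply: prodr_ge0 => v _; rewrite addr_ge0 ?normc_ge0.
  pose d := Num.min (Num.min 1 eta) (eta ^+ (size f).+1 / (C + 1)).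
  have d0 : 0 < d by rewrite !lt_min ltr01 eta0 divr_gt0 ?exprn_gt0// ltr_wpDl.
  have [x xS xa] := notin_near S a d0.
  have d1 : d <= 1 by rewrite !ge_min lexx.
  have d2 : d <= eta by rewrite !ge_min lexx orbT.
  have px : normc (\prod_(v <- a :: f) (x - v)) <= d * C.
    rewrite big_cons normcM ler_pM ?normc_ge0// normc_prod ler_prod// => v _.
    rewrite normc_ge0 /=.
    have -> : x - v = (x - a) + (a - v) by rewrite addrA subrK.
    by rewrite (le_trans (ler_normcD _ _))// lerD2r (le_trans xa).
  near=> e; have [we wm] := wP e.
  have pe : normc (\prod_(v <- z e) (x - v)) < eta ^+ (size f).+1.
    have pd : normc (\prod_(v <- z e) (x - v) - \prod_(v <- a :: f) (x - v)) < d.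
      by near: e; exact: zf.
    have dC : d * (C + 1) <= eta ^+ (size f).+1.
      by rewrite -ler_pdivlMr ?ltr_wpDl// !ge_min lexx !orbT.
    have := ler_distc (\prod_(v <- z e) (x - v)) (\prod_(v <- a :: f) (x - v)).
    move: dC; rewrite mulrDr mulr1; lra.
  have /hasP[v vz vx] : has (fun v => normc (x - v) < eta) (z e).
    apply: contraTT pe => /hasPn zN; rewrite -leNgt normc_prod.
    have -> : eta ^+ (size f).+1 = \prod_(v <- z e) eta.
      by rewrite big_const_seq count_predT iter_mulr_1 sz.
    rewrite big_seq [leRHS]big_seq ler_prod// => v vz.
    by rewrite ltW//= leNgt zN.
  rewrite normcB (le_lt_trans (wm v vz))//.
  have -> : a - v = - (x - a) + (x - v) by rewrite opprB addrA subrK.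
  rewrite (le_lt_trans (ler_normcD _ _))// normcN [eps]splitr ler_ltD//.
  exact: le_trans d2.
(* [a] joins the exceptional set because the factor x - w e, which tends to x - a, is divided
   out. *)
have [||z' [z'p z'f]] := IH (a :: S) (fun e => rem (w e) (z e)).
- by move=> e; rewrite size_rem ?sz//; have [] := wP e.
- move=> x; rewrite inE negb_or => /andP[xa xS].
  have xa0 : x - a != 0 by rewrite subr_eq0.
  have xw : clim F (fun e => x - w e) (x - a) by apply: climB => //; exact: clim_cst.
  have -> : \prod_(v <- f) (x - v) = (\prod_(v <- a :: f) (x - v)) * (x - a)^-1.
    by rewrite big_cons mulrC mulKf.
  apply: clim_near (climM (zf x xS) (climV xa0 xw)).
  near=> e; have [we _] := wP e.
  rewrite (perm_big _ (perm_to_rem we)) big_cons mulrC mulKf// -normc_gt0.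
  have : normc ((x - w e) - (x - a)) < normc (x - a).
    by near: e; apply: xw; rewrite normc_gt0.
  have := ler_distc (x - a) (x - w e); rewrite (normcB (x - a)); lra.
exists (fun e => w e :: z' e); split=> [e|[|i] /=] //.
  have [we _] := wP e.
  by rewrite perm_sym (perm_trans (perm_to_rem we))// perm_cons perm_sym.
exact: z'f.
Unshelve. all: by end_near. Qed.

(** * First-order perturbation of eigenvalues *)

(** Multiplying by E = 1 - B L gives o (u E) = - p E, which controls only one component of [u]. The
    rest, u B L = o (u L) + p L, is itself small, and o u = - p E + o^2 (u L) + o (p L). The bound
    |o| |L| <= 1/2 absorbs the middle term into the left side, at the price of the factor 2. *)
Lemma semisimple_bound (R : realType) n (B L : 'M[R[i]]_n) (u : 'rV[R[i]]_n)
    (o : R[i]) (c : R) :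
  B *m (1%:M - B *m L) = 0 -> u != 0 -> normc o <= 1 -> normc o * mxn L <= 1 / 2 ->
  mxn (u *m B - o *: u) <= c * mxn u ->
  normc o <= 2 * c * (mxn (1%:M - B *m L) + mxn L).
Proof.
move=> BE u0 o1 oL; set p := u *m B - o *: u => pu.
have uB : u *m B = o *: u + p by rewrite /p addrC subrK.
set E := 1%:M - B *m L in BE *.
have pE : p *m E = - o *: (u *m E).
  by rewrite /p mulmxBl -mulmxA BE mulmx0 sub0r -scalemxAl scaleNr.
have uE : u = u *m E + o *: (u *m L) + p *m L.
  have -> : u *m E = u - u *m B *m L by rewrite /E mulmxBr mulmx1 mulmxA.
  by rewrite uB mulmxDl -scalemxAl -addrA subrK.
have key : o *: u = - (p *m E) + o *: (o *: (u *m L)) + o *: (p *m L).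
  by rewrite {1}uE !scalerDr pE scaleNr opprK.
have un : 0 < mxn u.
  by rewrite lt_def mxn_ge0 andbT; apply: contra u0 => /eqP/mxn_eq0 ->.
have h1 := ler_mxnM p E; have h2 := ler_mxnM p L; have h3 := ler_mxnM u L.
have c0 : 0 <= c by rewrite -(pmulr_lge0 _ un) (le_trans _ pu)// mxn_ge0.
have h4 : normc o * mxn u <= mxn (p *m E) + normc o * (normc o * mxn (u *m L)) +
    normc o * mxn (p *m L).
  rewrite -mxnZ {1}key -mxnN opprD opprD opprK.
  rewrite (le_trans (ler_mxnD _ _))// lerD//; last by rewrite mxnN mxnZ.
  by rewrite (le_trans (ler_mxnD _ _))// lerD// mxnN !mxnZ.
have o0 := normc_ge0 o; have E0 := mxn_ge0 E; have L0 := mxn_ge0 L.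
have k1 : mxn (p *m E) <= c * mxn u * mxn E.
  by rewrite (le_trans h1)// ler_wpM2r.
have k2 : normc o * (normc o * mxn (u *m L)) <= normc o * mxn u * (1 / 2).
  rewrite -mulrA ler_wpM2l// (le_trans (ler_wpM2l o0 h3))// mulrCA ler_wpM2l//.
  exact: ltW.
have k3 : normc o * mxn (p *m L) <= c * mxn u * mxn L.
  rewrite (le_trans (ler_piMl (mxn_ge0 _) o1))// (le_trans h2)//.
  by rewrite ler_wpM2r.
rewrite -(ler_pM2r un).
move: h4 k1 k2 k3; set cu := c * mxn u; set ou := normc o * mxn u.
have -> : 2 * c * (mxn E + mxn L) * mxn u = 2 * (cu * mxn E + cu * mxn L).
  by rewrite /cu; ring.
lra.
Qed.

Lemma horner_char_poly (K : comNzRingType) n (B : 'M[K]_n) (x : K) :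
  (char_poly B).[x] = \det (x%:M - B).
Proof.
rewrite /char_poly -[LHS]/(horner_eval x _) -det_map_mx; congr determinant.
apply/matrixP => i j; rewrite !mxE /= /horner_eval hornerD hornerN hornerC.
by case: (i == j); rewrite ?mulr1n ?mulr0n ?hornerX ?horner0.
Qed.

Lemma eigenvalue_seq (K : closedFieldType) n (B : 'M[K]_n) :
  exists2 z : seq K, size z = n & char_poly B = \prod_(w <- z) ('X - w%:P).
Proof.
have [z zE] := closed_field_poly_normal (char_poly B).
move: zE; rewrite (monicP (char_poly_monic B)) scale1r => zE.
exists z => //; apply: succn_inj.
by rewrite -(size_char_poly B) zE size_prod_XsubC.
Qed.

(** A positive radius in [R[i]] has imaginary part zero, so balls may be taken with real radii. *)
Lemma nbhscP (R : realType) (a : R[i]) (P : set R[i]) :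
  nbhs a P <-> exists2 d : R, 0 < d & forall e : R[i], normc (e - a) < d -> P e.
Proof.
split=> [/nbhs_ballP[[d d'] /=]|[d d0 dP]].
  rewrite ltcE/= => /andP[/eqP -> d0] dP; exists d => // e ed; apply: dP.
  by rewrite /ball/= /ball_ distrC -[`|_|]/((normc (e - a))%:C) ltcR.
apply/nbhs_ballP; exists d%:C; first by rewrite /= ltcR.
move=> e; rewrite /ball/= /ball_ distrC -[`|_|]/((normc (e - a))%:C) ltcR.
exact: dP.
Qed.

Lemma nbhs0cP (R : realType) (P : set R[i]) :
  nbhs (0 : R[i]) P <-> exists2 d : R, 0 < d & forall e : R[i], normc e < d -> P e.
Proof.
by split=> [/nbhscP|] [d d0 dP]; [|apply/nbhscP]; exists d => // e;
  [rewrite -[e in normc e]subr0|rewrite subr0]; exact: dP.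
Qed.

Lemma clim_within (R : realType) (T : Type) (F : set_system T) {FF : Filter F}
    (D : set T) (g : T -> R[i]) a : clim F g a -> clim (within D F) g a.
Proof. by move=> ga e /ga; apply: filterS => x + _. Qed.

Lemma mxn_split (R : realType) m1 m2 n1 n2 (A : 'M[R[i]]_(m1 + m2, n1 + n2)) :
  mxn A = mxn (ulsubmx A) + mxn (ursubmx A) + (mxn (dlsubmx A) + mxn (drsubmx A)).
Proof.
rewrite /mxn big_split_ord /= -!big_split /=; congr (_ + _);
  apply: eq_bigr => i _; rewrite big_split_ord /=;
  by congr (_ + _); apply: eq_bigr => j _; rewrite !mxE.
Qed.

Lemma ler_mxn_block (R : realType) m1 m2 n1 n2 (A : 'M[R[i]]_(m1 + m2, n1 + n2)) :
  [/\ mxn (ulsubmx A) <= mxn A, mxn (ursubmx A) <= mxn A,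
      mxn (dlsubmx A) <= mxn A & mxn (drsubmx A) <= mxn A].
Proof.
have := mxn_split A; have := mxn_ge0 (ulsubmx A); have := mxn_ge0 (ursubmx A).
have := mxn_ge0 (dlsubmx A); have := mxn_ge0 (drsubmx A).
move: (mxn _) (mxn _) (mxn _) (mxn _) (mxn _) => a b c d x.
by split; lra.
Qed.

Section first_order_perturbation.
Variables (R : realType) (r s : nat) (F : R[i] -> 'M[R[i]]_(r + s)).
Variables (F0 F1 : 'M[R[i]]_(r + s)) (f0 : R[i]) (f : 'I_r -> R[i]) (K : R).
Hypothesis F_exp :
  \forall e \near nbhs (0 : R[i]), mxn (F e - F0 - e *: F1) <= K * normc e ^+ 2.
Hypothesis F0_diag : is_diag_mx F0.
Hypothesis F0_ul : forall i, F0 (lshift s i) (lshift s i) = f0.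
Hypothesis F0_dr : forall j, F0 (rshift r j) (rshift r j) != f0.
Hypothesis f_eig : eigenvalue_list (ulsubmx F1) f.

(** Punctured neighbourhoods of 0, since the rescaled quantities are quotients by [e]. *)
Let G : set_system R[i] := within (fun e => e != 0) (nbhs (0 : R[i])).

Local Instance G_filter : Filter G.
Proof. exact: within_filter. Qed.

Lemma clim_id0 : clim (nbhs (0 : R[i])) id 0.
Proof.
by move=> eps eps0; apply/nbhs0cP; exists eps => // e; rewrite subr0.
Qed.

Lemma clim_slope i j : clim G (fun e => (F e i j - F0 i j) / e) (F1 i j).
Proof.
move=> eps eps0; rewrite /G near_withinE.
have : \forall e \near nbhs (0 : R[i]), normc (e - 0) < eps / (`|K| + 1).
  by apply: clim_id0; rewrite divr_gt0// ltr_wpDl.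
apply: filterS2 F_exp => e FE; rewrite subr0 ltr_pdivlMr ?ltr_wpDl// => eK e0.
have ne0 : 0 < normc e by rewrite normc_gt0.
have -> : (F e i j - F0 i j) / e - F1 i j = (F e - F0 - e *: F1) i j / e.
  by rewrite !mxE; field.
rewrite normcM normcV ltr_pdivrMr//.
rewrite (le_lt_trans (ler_entry_mxn _ _ _))// (le_lt_trans FE)//.
rewrite expr2 mulrA ltr_pM2r// (le_lt_trans _ eK)// mulrC ler_wpM2l ?normc_ge0//.
by rewrite (le_trans (ler_norm _))// lerDl.
Qed.

Lemma clim_F i j : clim (nbhs (0 : R[i])) (fun e => F e i j) (F0 i j).
Proof.
move=> eps eps0.
(* At e = 0 the remainder bound vanishes, which fixes the value of [F] there; the punctured limit
   then extends to full neighbourhoods. *)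
have Feq : F 0 = F0.
  have := nbhs_singleton F_exp; rewrite scale0r subr0 normc0 expr0n mulr0 => h.
  apply/eqP; rewrite -subr_eq0; apply/eqP/mxn_eq0/eqP.
  by rewrite eq_le h mxn_ge0.
have lim_cG : clim G (fun e => (F e i j - F0 i j) / e * e) (F1 i j * 0).
  apply: climM; first exact: clim_slope.
  by apply: clim_within; exact: clim_id0.
have := lim_cG eps eps0; rewrite {1}/G near_withinE; apply: filterS => e.
have [->|e0] := eqVneq e 0; first by rewrite Feq subrr normc0.
by move=> /(_ isT); rewrite mulr0 subr0 divfK.
Qed.

Lemma det_F0 x : \det (x%:M - F0) = \prod_j (x - F0 j j).
Proof.
have /is_diag_mxP D : is_diag_mx F0 by [].
have -> : x%:M - F0 = diag_mx (\row_j (x - F0 j j)).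
  apply/matrixP => i j; rewrite !mxE; case: eqVneq => [->|ij]; first by rewrite !mulr1n.
  by rewrite !mulr0n D ?subrr.
by rewrite det_diag; apply: eq_bigr => j _; rewrite mxE.
Qed.

(** det(x - F e) converges for every x, so [match_roots] applies with no exceptional point. The
    resulting labelling separates the r roots tending to [f0] from the s others. *)
Lemma unscaled_roots : exists z : R[i] -> 'I_(r + s) -> R[i],
  (forall e, eigenvalue_list (F e) (z e)) /\
  (forall j, clim (nbhs (0 : R[i])) (fun e => z e j) (F0 j j)).
Proof.
have /choice[z zP] : forall e, exists z : seq R[i],
    size z = (r + s)%N /\ char_poly (F e) = \prod_(w <- z) ('X - w%:P).
  by move=> e; have [z] := eigenvalue_seq (F e); exists z.
pose d := [seq F0 j j | j <- enum 'I_(r + s)].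
have sd : size d = (r + s)%N by rewrite size_map size_enum_ord.
have [||z' [z'p z'd]] := @match_roots R _ (nbhs (0 : R[i])) _ [::] d z.
- by move=> e; rewrite sd; case: (zP e).
- move=> x _; rewrite big_map big_enum /= -det_F0.
  apply: (@clim_near _ _ _ _ (fun e => \det (x%:M - F e))).
    near=> e; rewrite -horner_char_poly; have [_ ->] := zP e.
    rewrite horner_prod; apply: eq_bigr => w _.
    by rewrite hornerXsubC.
  apply: clim_det => i j; rewrite !mxE.
  under eq_fun do rewrite !mxE.
  by apply: climB; [exact: clim_cst|exact: clim_F].
exists (fun e j => (z' e)`_j); split=> [e|j].
  have [sz zE] := zP e; rewrite /eigenvalue_list zE -(perm_big _ (z'p e)).
  by rewrite (big_nth 0) (perm_size (z'p e)) sz big_mkord.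
have -> : F0 j j = d`_j by rewrite (nth_map j) ?size_enum_ord// nth_ord_enum.
by apply: z'd; rewrite sd.
Unshelve. all: by end_near. Qed.

Lemma scaled_det e x : e != 0 -> \det ((f0 + e * x)%:M - F e) =
  e ^+ r * \det (block_mx
     (e^-1 *: ulsubmx ((f0 + e * x)%:M - F e))
     (e^-1 *: ursubmx ((f0 + e * x)%:M - F e))
     (dlsubmx ((f0 + e * x)%:M - F e)) (drsubmx ((f0 + e * x)%:M - F e))).
Proof.
move=> e0; set M := _%:M - F e.
have {1}-> : M = block_mx e%:M 0 0 1%:M *m
   block_mx (e^-1 *: ulsubmx M) (e^-1 *: ursubmx M) (dlsubmx M) (drsubmx M).
  rewrite mulmx_block !mul0mx !mul1mx !addr0 !add0r !mul_scalar_mx.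
  by rewrite !scalerA divff// !scale1r submxK.
by rewrite det_mulmx det_ublock det_scalar det1 mulr1.
Qed.

(** At f0 + e x the characteristic polynomial is e^r times the product sought times the product
    [q e] over the other s roots. The factor e^r is also what [scaled_det] extracts, and [q e] has
    the nonzero limit [q0], so both can be divided out. *)
Lemma scaled_roots (z : R[i] -> 'I_(r + s) -> R[i]) :
  (forall e, eigenvalue_list (F e) (z e)) ->
  (forall j, clim (nbhs (0 : R[i])) (fun e => z e j) (F0 j j)) ->
  forall x, clim G (fun e => \prod_(i < r) (x - (z e (lshift s i) - f0) / e))
    (\prod_(i < r) (x - f i)).
Proof.
move=> zE zl x.
have offd k l : k != l -> F0 k l = 0 by move=> kl; move/is_diag_mxP: F0_diag; apply.
have clim_fx : clim G (fun e => f0 + e * x) f0.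
  rewrite -[X in clim _ _ X]addr0 -(mul0r x).
  apply: climD; first exact: clim_cst.
  by apply: climM; [apply: clim_within; exact: clim_id0|exact: clim_cst].
pose q e := \prod_(j < s) (f0 + e * x - z e (rshift r j)).
pose q0 := \prod_(j < s) (f0 - F0 (rshift r j) (rshift r j)).
have q00 : q0 != 0 by apply/prodf_neq0 => j _; rewrite subr_eq0 eq_sym.
have ql : clim G q q0.
  by apply: clim_prod => j _; apply: climB => //; apply: clim_within; exact: zl.
pose B e := block_mx
     (e^-1 *: ulsubmx ((f0 + e * x)%:M - F e))
     (e^-1 *: ursubmx ((f0 + e * x)%:M - F e))
     (dlsubmx ((f0 + e * x)%:M - F e)) (drsubmx ((f0 + e * x)%:M - F e)).
(* The lower-left block is not divided by [e] and tends to the corresponding block of the diagonal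
   [F0], which is zero. The limit is thus block triangular and its determinant splits. *)
have dl : clim G (fun e => \det (B e)) ((\prod_(i < r) (x - f i)) * q0).
  have -> : \prod_(i < r) (x - f i) * q0 = \det (block_mx (x%:M - ulsubmx F1)
      (- ursubmx F1) 0 (f0%:M - drsubmx F0)).
    rewrite det_ublock -horner_char_poly f_eig horner_prod; congr (_ * _).
      by apply: eq_bigr => i _; rewrite hornerXsubC.
    have -> : f0%:M - drsubmx F0 = diag_mx (\row_j (f0 - F0 (rshift r j) (rshift r j))).
      apply/matrixP => i j; rewrite !mxE; case: eqVneq => [->|ij]; first by rewrite !mulr1n.
      rewrite !mulr0n sub0r; apply/eqP; rewrite oppr_eq0; apply/eqP.
      by rewrite offd// (inj_eq (@rshift_inj _ _)).
    by rewrite det_diag; apply: eq_bigr => j _; rewrite mxE.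
  apply: clim_det => i j; rewrite /B.
  case: (split_ordP i) => {}i ->; case: (split_ordP j) => {}j ->;
    rewrite ?(block_mxEul, block_mxEur, block_mxEdl, block_mxEdr) !mxE.
  - apply: (@clim_near _ _ _ _ (fun e => x *+ (i == j) -
      (F e (lshift s i) (lshift s j) - F0 (lshift s i) (lshift s j)) / e)).
      rewrite /G near_withinE; near=> e => e0; rewrite block_mxEul !mxE.
      rewrite (inj_eq (@lshift_inj _ _)).
      have [->|ij] := eqVneq i j; rewrite ?mulr1n ?mulr0n.
        by rewrite F0_ul; field.
      by rewrite (offd (lshift s i)) ?(inj_eq (@lshift_inj _ _))//; field.
    apply: climB; [exact: clim_cst|exact: clim_slope].
  - apply: (@clim_near _ _ _ _ (fun e => -
      ((F e (lshift s i) (rshift r j) - F0 (lshift s i) (rshift r j)) / e))).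
      rewrite /G near_withinE; near=> e => e0; rewrite block_mxEur !mxE.
      by rewrite offd eq_lrshift// mulr0n; field.
    by apply: climN; exact: clim_slope.
  - apply: (@clim_near _ _ _ _ (fun e => - F e (rshift r i) (lshift s j))).
      by near=> e; rewrite block_mxEdl !mxE eq_rlshift mulr0n sub0r.
    rewrite -oppr0 -(offd (rshift r i) (lshift s j)) ?eq_rlshift//.
    by apply: climN; apply: clim_within; exact: clim_F.
  - apply: (@clim_near _ _ _ _ (fun e => (f0 + e * x) *+ (i == j) -
      F e (rshift r i) (rshift r j))).
      by near=> e; rewrite block_mxEdr !mxE (inj_eq (@rshift_inj _ _)).
    apply: climB; last by apply: clim_within; exact: clim_F.
    by case: (i == j); rewrite ?mulr1n ?mulr0n//; exact: clim_cst.
have q1 : \forall e \near G, q e != 0.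
  near=> e; rewrite -normc_gt0.
  have : normc (q e - q0) < normc q0 by near: e; apply: ql; rewrite normc_gt0.
  have := ler_distc q0 (q e); rewrite (normcB q0); lra.
rewrite -[X in clim _ _ X](mulfK q00).
apply: clim_near (climM dl (climV q00 ql)).
have Gne : \forall e \near G, e != 0 by rewrite /G near_withinE; near=> e.
near=> e; have e0 : e != 0 by near: e.
have qe : q e != 0 by near: e.
apply: (mulIf qe); rewrite divfK//; apply: (mulfI (expf_neq0 r e0)).
rewrite -scaled_det// -horner_char_poly zE horner_prod big_split_ord /= mulrA.
congr (_ * _); last by apply: eq_bigr => j _; rewrite hornerXsubC.
rewrite -[X in _ ^+ X]card_ord -prodr_const -big_split /=.
by apply: eq_bigr => i _; rewrite hornerXsubC; field.
Unshelve. all: by end_near. Qed.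

(** The limit of the slopes, which carries no rate, makes o = (l e - f0) / e - a small enough for
    the absorption in [semisimple_bound]; the block equations of an eigenvector then supply the
    rate. *)
Lemma semisimple_slope (a : R[i]) (l : R[i] -> R[i]) :
  semisimple_eigenvalue (ulsubmx F1) a ->
  (forall e, root (char_poly (F e)) (l e)) ->
  clim G (fun e => (l e - f0) / e) a ->
  exists C : R, \forall e \near G, normc ((l e - f0) / e - a) <= C * normc e.
Proof.
move=> /semisimple_pinv[L BE] lroot la.
set B := ulsubmx F1 - a%:M in BE.
have K0 : 0 <= `|K| by [].
(* For |e| <= 1, K' |e| bounds the norm of F e - F0. *)
pose K' := `|K| + mxn F1.
have K'0 : 0 <= K' by rewrite addr_ge0 ?mxn_ge0.
pose D := f0%:M - drsubmx F0; pose d := mxn (invmx D).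
have d0 : 0 <= d by exact: mxn_ge0.
have Du : D \in unitmx.
  have -> : D = diag_mx (\row_j (f0 - F0 (rshift r j) (rshift r j))).
    apply/matrixP => i j; rewrite !mxE; case: eqVneq => [->|ij]; first by rewrite !mulr1n.
    rewrite !mulr0n sub0r; apply/eqP; rewrite oppr_eq0; apply/eqP.
    move/is_diag_mxP: F0_diag; apply.
    by have : rshift r i != rshift r j by rewrite (inj_eq (@rshift_inj _ _)).
  rewrite unitmxE det_diag unitfE; apply/prodf_neq0 => j _.
  by rewrite mxE subr_eq0 eq_sym.
(* c |e| |u1| will bound u1 (B - o). The first term is the second-order remainder in the upper-left
   block; the second is the detour through the lower block, where |u2| <= 2 d K' |e| |u1| is coupled
   back with strength K' |e|. *)
pose c := `|K| + 2 * d * K' * K'.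
exists (2 * c * (mxn (1%:M - B *m L) + mxn L)).
have ll : clim G (fun e => (l e - f0) / e * e) (a * 0).
  by apply: climM => //; apply: clim_within; exact: clim_id0.
have L0 := mxn_ge0 L.
(* Three smallness conditions. This one gives |o| <= 1 and |o| |L| <= 1/2 for [semisimple_bound].
   The next two, on |e| and on |l e - f0|, each absorb a quarter of |u2| in the lower block
   equation, whence the factor 2 in the bound of |u2|. *)
have no1 : \forall e \near G, normc ((l e - f0) / e - a) < Num.min 1 (1 / (2 * (mxn L + 1))).
  by apply: la; rewrite lt_min ltr01 divr_gt0// mulr_gt0// ltr_wpDl.
have ne1 : \forall e \near G, normc e < Num.min 1 (1 / (4 * (d * K' + 1))).
  rewrite /G near_withinE; apply/nbhs0cP; exists (Num.min 1 (1 / (4 * (d * K' + 1)))).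
    by rewrite lt_min ltr01 divr_gt0// mulr_gt0// ltr_wpDl// mulr_ge0.
  by [].
have nl1 : \forall e \near G, normc ((l e - f0) / e * e - a * 0) < 1 / (4 * (d + 1)).
  by apply: ll; rewrite divr_gt0// mulr_gt0// ltr_wpDl.
rewrite /G !near_withinE in no1 ne1 nl1 *.
near=> e => e0.
have FE : mxn (F e - F0 - e *: F1) <= K * normc e ^+ 2 by near: e.
have o1' : e != 0 -> normc ((l e - f0) / e - a) < Num.min 1 (1 / (2 * (mxn L + 1))).
  by near: e.
have e1' : e != 0 -> normc e < Num.min 1 (1 / (4 * (d * K' + 1))) by near: e.
have l1' : e != 0 -> normc ((l e - f0) / e * e - a * 0) < 1 / (4 * (d + 1)).
  by near: e.
move: (o1' e0) (e1' e0) (l1' e0) => o1 e1 l1.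
have ne0 : 0 < normc e by rewrite normc_gt0.
set o := _ / e - a in o1 *.
rewrite mulr0 subr0 divfK // in l1.
move: o1 e1; rewrite !lt_min => /andP[ o1 o2] /andP[e1 e2].
set H := F e - F0 - e *: F1 in FE; set G1 := F e - F0.
have HK : mxn H <= `|K| * normc e ^+ 2.
  by rewrite (le_trans FE)// ler_wpM2r ?exprn_ge0 ?normc_ge0// ler_norm.
have G1K : mxn G1 <= K' * normc e.
  have -> : G1 = H + e *: F1 by rewrite /H subrK.
  rewrite (le_trans (ler_mxnD _ _))// mxnZ mulrDl (mulrC (mxn F1)) lerD2r.
  by rewrite (le_trans HK)// ler_wpM2l// expr2 ler_piMr ?normc_ge0// ltW.
have [v vF v0] : exists2 v : 'rV_(r + s), v *m F e = l e *: v & v != 0.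
  by apply/eigenvalueP; rewrite eigenvalue_root_char.
set u1 := lsubmx v; set u2 := rsubmx v.
have vE : v = row_mx u1 u2 by rewrite hsubmxK.
move: vF; rewrite {1 2}vE -[F e]submxK mul_row_block scale_row_mx => /eq_row_mx[v1 v2].
have offd k m : k != m -> F0 k m = 0.
  by move=> km; move/is_diag_mxP: F0_diag; apply.
have urE : ursubmx G1 = ursubmx (F e).
  by apply/matrixP => i j; rewrite !mxE offd ?subr0// eq_lrshift.
have dlE : dlsubmx G1 = dlsubmx (F e).
  by apply/matrixP => i j; rewrite !mxE offd ?subr0// eq_rlshift.
have drE : drsubmx G1 = drsubmx (F e) - drsubmx F0.
  by apply/matrixP => i j; rewrite !mxE.
have ulE : ulsubmx H = ulsubmx (F e) - f0%:M - e *: ulsubmx F1.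
  apply/matrixP => i j; rewrite !mxE; case: eqVneq => [->|ij]; first by rewrite F0_ul.
  by rewrite offd// (inj_eq (@lshift_inj _ _)).
have [_ gur gdl gdr] := ler_mxn_block G1; have [hul _ _ _] := ler_mxn_block H.
have gurK : mxn (ursubmx G1) <= K' * normc e := le_trans gur G1K.
have gdrK : mxn (drsubmx G1) <= K' * normc e := le_trans gdr G1K.
have gdlK : mxn (dlsubmx G1) <= K' * normc e := le_trans gdl G1K.
have hulK : mxn (ulsubmx H) <= `|K| * normc e ^+ 2 := le_trans hul HK.
have u1n := mxn_ge0 u1; have u2n := mxn_ge0 u2.
have u2D : u2 *m D = u1 *m ursubmx G1 + u2 *m drsubmx G1 - (l e - f0) *: u2.
  rewrite urE drE /D !mulmxBr mul_mx_scalar scalerBl -v2 addrA.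
  by rewrite opprB [RHS]addrC addrA subrK.
(* The invertible [D] turns the second block equation into [u2 = O(e) u1]. *)
have u2b : mxn u2 <= 2 * d * K' * normc e * mxn u1.
  have u2E : u2 = (u1 *m ursubmx G1 + u2 *m drsubmx G1 - (l e - f0) *: u2) *m invmx D.
    by rewrite -u2D mulmxK.
  have : mxn u2 <= mxn u1 * (K' * normc e) * d + mxn u2 * (K' * normc e) * d +
      normc (l e - f0) * mxn u2 * d.
    rewrite -!(mulrDl _ _ d) {1}u2E (le_trans (ler_mxnM _ _))// ler_wpM2r//.
    rewrite (le_trans (ler_mxnD _ _))// lerD ?mxnN ?mxnZ//.
    by rewrite (le_trans (ler_mxnD _ _))// lerD// (le_trans (ler_mxnM _ _))// ler_wpM2l.
  have k1 : mxn u2 * (K' * normc e) * d <= mxn u2 / 4.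
    rewrite -mulrA ler_wpM2l//; move: e2.
    rewrite ltr_pdivlMr ?mulr_gt0 ?ltr_wpDl ?mulr_ge0// => e2.
    have : 0 <= normc e by exact: ltW.
    have -> : K' * normc e * d = normc e * (4 * (d * K' + 1)) / 4 - normc e by field.
    lra.
  have k2 : normc (l e - f0) * mxn u2 * d <= mxn u2 / 4.
    rewrite mulrAC mulrC ler_wpM2l//; move: l1.
    rewrite ltr_pdivlMr ?mulr_gt0 ?ltr_wpDl// => l2.
    have := normc_ge0 (l e - f0).
    have -> : normc (l e - f0) * d =
      normc (l e - f0) * (4 * (d + 1)) / 4 - normc (l e - f0) by field.
    lra.
  have -> : 2 * d * K' * normc e * mxn u1 = 2 * (mxn u1 * (K' * normc e) * d) by ring.
  lra.
have u10 : u1 != 0.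
  apply: contra v0 => /eqP u10; rewrite vE u10.
  have n0 m n : mxn (0 : 'M[R[i]]_(m, n)) = 0.
    by rewrite -(scale0r 0) mxnZ normc0 mul0r.
  move: u2b; rewrite u10 n0 mulr0 => u2b.
  have /mxn_eq0-> : mxn u2 = 0 by apply/eqP; rewrite eq_le u2b.
  by rewrite row_mx0.
have -> : 2 * c * (mxn (1%:M - B *m L) + mxn L) * normc e =
    2 * (c * normc e) * (mxn (1%:M - B *m L) + mxn L) by ring.
apply: (semisimple_bound BE u10 (ltW o1)).
  move: o2; rewrite ltr_pdivlMr ?mulr_gt0 ?ltr_wpDl// => o2.
  have := normc_ge0 o.
  have -> : normc o * mxn L = normc o * (2 * (mxn L + 1)) / 2 - normc o by field.
  lra.
(* The upper block equation with [f0] subtracted: e (B - o) equals e F1' - (l e - f0), with F1' the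
   upper-left block of [F1], so only the remainder [H] and the coupling to [u2] survive. *)
have key : e *: (u1 *m B - o *: u1) = - (u1 *m ulsubmx H) - u2 *m dlsubmx G1.
  rewrite ulE dlE /B !mulmxBr !mul_mx_scalar -scalemxAr !scalerBr.
  have -> : u2 *m dlsubmx (F e) = l e *: u1 - u1 *m ulsubmx (F e).
    by rewrite -v1 addrAC subrr add0r.
  have -> : e *: (o *: u1) = (l e - f0) *: u1 - e *: (a *: u1).
    by rewrite !scalerA -scalerBl; congr (_ *: _); rewrite /o; field.
  move: (u1 *m ulsubmx (F e)) (u1 *m ulsubmx F1) => x y.
  by apply/rowP => j; rewrite !mxE; ring.
rewrite -(ler_pM2l ne0) -mxnZ key -opprD mxnN (le_trans (ler_mxnD _ _))//.
have h1 : mxn (u1 *m ulsubmx H) <= mxn u1 * (`|K| * normc e ^+ 2).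
  by rewrite (le_trans (ler_mxnM _ _))// ler_wpM2l.
have h2 : mxn (u2 *m dlsubmx G1) <= (2 * d * K' * normc e * mxn u1) * (K' * normc e).
  by rewrite (le_trans (ler_mxnM _ _))// ler_pM ?mxn_ge0.
have -> : normc e * (c * normc e * mxn u1) =
    mxn u1 * (`|K| * normc e ^+ 2) + (2 * d * K' * normc e * mxn u1) * (K' * normc e).
  by rewrite /c; ring.
exact: lerD.
Unshelve. all: by end_near. Qed.

End first_order_perturbation.

Lemma first_order_eigenvalues (R : realType) r s (F : R[i] -> 'M[R[i]]_(r + s))
    (F0 F1 : 'M[R[i]]_(r + s)) (f0 : R[i]) (f : 'I_r -> R[i]) (K : R) :
  (\forall e \near nbhs (0 : R[i]),
     mxn (F e - F0 - e *: F1) <= K * normc e ^+ 2) ->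
  is_diag_mx F0 ->
  (forall i, F0 (lshift s i) (lshift s i) = f0) ->
  (forall j, F0 (rshift r j) (rshift r j) != f0) ->
  eigenvalue_list (ulsubmx F1) f ->
  exists lam : R[i] -> 'I_(r + s) -> R[i],
  [/\ forall e, eigenvalue_list (F e) (lam e),
      forall j, clim (nbhs (0 : R[i])) (fun e => lam e j) (F0 j j),
      forall i (eps : R), 0 < eps -> \forall e \near nbhs (0 : R[i]),
        normc (lam e (lshift s i) - (f0 + e * f i)) <= eps * normc e &
      forall i, semisimple_eigenvalue (ulsubmx F1) (f i) ->
        exists C : R, \forall e \near nbhs (0 : R[i]),
          normc (lam e (lshift s i) - (f0 + e * f i)) <= C * normc e ^+ 2].
Proof.
move=> F_exp F0_diag F0_ul F0_dr f_eig.
set G := within (fun e : R[i] => e != 0) (nbhs (0 : R[i])).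
have G_filter : Filter G by exact: within_filter.
have Feq : F 0 = F0.
  have := nbhs_singleton F_exp; rewrite scale0r subr0 normc0 expr0n mulr0 => h.
  apply/eqP; rewrite -subr_eq0; apply/eqP/mxn_eq0/eqP.
  by rewrite eq_le h mxn_ge0.
have [z [zE zl]] := unscaled_roots F_exp F0_diag.
pose w (e : R[i]) := [seq (z e (lshift s i) - f0) / e | i <- enum 'I_r].
pose fs := [seq f i | i <- enum 'I_r].
have [||w' [w'p w'f]] := @match_roots R _ G _ [::] fs w.
- by move=> e; rewrite !size_map.
- move=> x _; rewrite big_map big_enum /=.
  apply: clim_near (scaled_roots F_exp F0_diag F0_ul F0_dr f_eig zE zl x).
  by near=> e; rewrite big_map big_enum.
(* For nonzero [e] the matched slopes are scaled back. At e = 0 the slopes carry no information, and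
   the diagonal of [F0] makes the error terms vanish at the centre of the neighbourhood. *)
pose lam (e : R[i]) j := if e == 0 then F0 j j else
  match fintype.split j with inl i => f0 + e * (w' e)`_i | inr _ => z e j end.
have lamE (e : R[i]) i : e != 0 -> (lam e (lshift s i) - f0) / e = (w' e)`_i.
  move=> e0; rewrite /lam (negPf e0).
  by rewrite -[lshift s i]/(unsplit (inl i)) fintype.unsplitK addrAC subrr add0r mulrC mulKf.
have lamB (e : R[i]) i : e != 0 -> lam e (lshift s i) - (f0 + e * f i) = e * ((w' e)`_i - f i).
  by move=> e0; rewrite -lamE//; field.
have lam0 i : lam 0 (lshift s i) - (f0 + 0 * f i) = 0.
  by rewrite /lam eqxx F0_ul mul0r addr0 subrr.
have w'l (i : 'I_r) : clim G (fun e => (w' e)`_i) (f i).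
  have -> : f i = fs`_i by rewrite (nth_map i) ?size_enum_ord// nth_ord_enum.
  by apply: w'f; rewrite size_map size_enum_ord.
have lam_eig e : eigenvalue_list (F e) (lam e).
  rewrite /eigenvalue_list /lam; have [->|e0] := eqVneq e 0.
    by rewrite Feq char_poly_trig// is_diag_mx_is_trig.
  rewrite zE !big_split_ord /=; congr (_ * _).
    transitivity (\prod_(u <- w' e) ('X - (f0 + e * u)%:P)).
      rewrite (perm_big _ (w'p e)) big_map big_enum /=.
      by apply: eq_bigr => i _; congr ('X - _%:P); field.
    rewrite (big_nth 0) (perm_size (w'p e)) size_map size_enum_ord big_mkord.
    by apply: eq_bigr => i _; rewrite -[lshift s i]/(unsplit (inl i)) fintype.unsplitK.
  by apply: eq_bigr => j _; rewrite -[rshift r j]/(unsplit (inr j)) fintype.unsplitK.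
have small (i : 'I_r) (eps : R) : 0 < eps -> \forall e \near nbhs (0 : R[i]),
    normc (lam e (lshift s i) - (f0 + e * f i)) <= eps * normc e.
  move=> eps0; have := w'l i eps eps0; rewrite {1}/G near_withinE.
  apply: filterS => e we; have [->|e0] := eqVneq e 0.
    by rewrite lam0 normc0 mulr0.
  by rewrite lamB// normcM mulrC ler_wpM2r ?normc_ge0// ltW// we.
exists lam; split=> // [j|i ss].
- case: (split_ordP j) => [i|{}j] ->.
    move=> eps eps0; rewrite F0_ul.
    have K0 : 0 < 1 + normc (f i) by rewrite ltr_pwDl// normc_ge0.
    have ei : \forall e \near nbhs (0 : R[i]), normc (e - 0) < eps / (1 + normc (f i)).
      by apply: clim_id0; rewrite divr_gt0.
    apply: filterS2 (small i 1 ltr01) ei => e; rewrite mul1r subr0 ltr_pdivlMr// => le1 le2.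
    have -> : lam e (lshift s i) - f0 = (lam e (lshift s i) - (f0 + e * f i)) + e * f i.
      by rewrite opprD addrA subrK.
    rewrite (le_lt_trans (ler_normcD _ _))// (le_lt_trans _ le2)// mulrDr mulr1 normcM.
    by rewrite lerD2r.
  move=> eps eps0; apply: filterS (zl (rshift r j) eps eps0) => e; rewrite /lam.
  have [_|e0] := eqVneq e 0; first by rewrite subrr normc0.
  by rewrite -[rshift r j]/(unsplit (inr j)) fintype.unsplitK.
- have [||C CP] := semisimple_slope F_exp F0_diag F0_ul F0_dr (l := fun e => lam e (lshift s i)) ss.
  + move=> e; rewrite lam_eig; apply/rootP; rewrite horner_prod (bigD1 (lshift s i))//=.
    by rewrite hornerXsubC subrr mul0r.
  + apply: clim_near (w'l i); rewrite {1}/G near_withinE; near=> e => e0.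
    by rewrite lamE.
  exists C; move: CP; rewrite near_withinE; apply: filterS => e Ce.
  have [->|e0] := eqVneq e 0; first by rewrite lam0 normc0 expr0n mulr0.
  rewrite lamB// normcM mulrC expr2 mulrA ler_wpM2r ?normc_ge0//.
  by rewrite -lamE// Ce.
Unshelve. all: by end_near. Qed.

(** * Entrywise convergence and remainders of power series *)

Lemma clim_cvgP (R : realType) (T : Type) (F : set_system T) {FF : Filter F}
    (g : T -> R[i]) (a : R[i]) : clim F g a <-> g @ F --> a.
Proof.
split=> [ga P /nbhscP[d d0 dP]|ga eps eps0].
  by apply: filterS (ga d d0) => x; exact: dP.
by apply: (ga [set y | normc (y - a) < eps]); apply/nbhscP; exists eps.
Qed.

Lemma mx_cvg_clim (R : realType) m n (T : Type) (F : set_system T) {FF : Filter F}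
    (g : T -> 'M[R[i]]_(m, n)) (M : 'M[R[i]]_(m, n)) :
  g @ F --> M <-> forall i j, clim F (fun x => g x i j) (M i j).
Proof.
split=> [gM i j eps eps0|gM].
  have : nbhs M [set N : 'M[R[i]]_(m, n) | normc (N i j - M i j) < eps].
    exists (fun k l => [set y : R[i] | normc (y - M k l) < eps]); last by move=> N; exact.
    by move=> k l; apply/nbhscP; exists eps.
  by move/gM.
move=> P [Q Qn QP].
have : \forall x \near F, forall i j, Q i j (g x i j).
  apply: filter_forall => i; apply: filter_forall => j.
  have /nbhscP[d d0 dQ] := Qn i j.
  by apply: filterS (gM i j d d0) => x; exact: dQ.
by apply: filterS => x; exact: QP.
Qed.

Lemma mx_uniform_clim (R : realType) m n (D : choiceType) (F : set_system (D -> 'M[R[i]]_(m, n)))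
    (FF : Filter F) (h : D -> 'M[R[i]]_(m, n)) : {uniform, F --> h} ->
  forall eps : R, 0 < eps -> 
  F [set g : D -> 'M[R[i]]_(m, n) | forall t i j, normc (g t i j - h t i j) < eps].
Proof.
move=> Fh eps eps0.
have := Fh [set g : D -> 'M[R[i]]_(m, n) | forall t i j, normc (g t i j - h t i j) < eps].
apply; apply/uniform_nbhs.
exists [set MN : 'M[R[i]]_(m, n) * 'M[R[i]]_(m, n) | forall i j, normc (MN.2 i j - MN.1 i j) < eps].
split; last by move=> g gE t i j; exact: gE.
exists (fun _ _ => [set xy : R[i] * R[i] | ball xy.1 eps%:C xy.2]).
  move=> i j; have e0 : 0 < eps%:C by rewrite ltcR.
  exact: (entourage_ball _ (PosNum e0)).
move=> MN /= MNb i j; have := MNb i j.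
by rewrite /ball/= /ball_ distrC -[`|_|]/((normc (MN.2 i j - MN.1 i j))%:C) ltcR.
Qed.

(** Each of the finitely many indices below [N] has its own bound; the induction absorbs them one at
    a time. *)
Lemma eventually_bounded (R : realDomainType) (D : Type) (u : nat -> D -> R) N (K : R) :
  (forall n, exists K, forall t, u n t <= K) ->
  (forall n t, (N <= n)%N -> u n t <= K) ->
  exists2 K', 0 <= K' & forall n t, u n t <= K'.
Proof.
move=> un; elim: N K => [|N IH] K uK.
  by exists `|K| => // n t; rewrite (le_trans (uK n t _))// ler_norm.
have [K1 K1P] := un N; apply: (IH (Num.max K1 K)) => n t.
rewrite leq_eqVlt => /predU1P[<-|nN]; rewrite le_max; first by rewrite K1P.
by rewrite uK ?orbT.
Qed.

(** The terms are dominated by K q^k with q = |e| / rho <= 1/2, so those of degree at least 2 sum to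
    at most 2 K q^2. *)
Lemma power_series_remainder (R : realType) (c : nat -> R[i]) (e L : R[i]) (rho K : R) :
  0 < rho -> (forall k, normc (c k) * rho ^+ k <= K) -> normc e <= rho / 2 ->
  clim \oo (fun n => \sum_(k < n) e ^+ k * c k) L ->
  normc (L - c 0%N - e * c 1%N) <= 2 * K * (normc e / rho) ^+ 2.
Proof.
move=> rho0 cK er eL.
set q := normc e / rho; have q0 : 0 <= q by rewrite divr_ge0 ?normc_ge0// ltW.
have q2 : q <= 1 / 2 by rewrite ler_pdivrMr// mulrC mulrA mulr1.
have K0 : 0 <= K by rewrite (le_trans _ (cK 0%N))// mulr_ge0 ?normc_ge0// exprn_ge0// ltW.
have term k : normc (e ^+ k * c k) <= K * q ^+ k.
  rewrite normcM normcX /q expr_div_n mulrA ler_pdivlMr ?exprn_gt0//.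
  by rewrite -mulrA [leRHS]mulrC ler_wpM2l ?exprn_ge0 ?normc_ge0.
(* The factor 1 - (1/2)^n is the finite geometric sum up to the constant; keeping it makes the
   induction close. *)
have part n : normc (\sum_(k < n.+2) e ^+ k * c k - c 0%N - e * c 1%N) <=
    2 * K * q ^+ 2 * (1 - (1 / 2) ^+ n).
  elim: n => [|n IH].
    rewrite !big_ord_recr big_ord0 /= [X in normc X](_ : _ = 0); last by ring.
    by rewrite normc0 expr0 subrr mulr0.
  rewrite big_ord_recr /=; set S := \sum_(k < n.+2) _ in IH *.
  have -> : S + e ^+ n.+2 * c n.+2 - c 0%N - e * c 1%N =
    (S - c 0%N - e * c 1%N) + e ^+ n.+2 * c n.+2 by ring.
  rewrite (le_trans (ler_normcD _ _))// (le_trans (lerD IH (term _)))//.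
  have qn : K * q ^+ 2 * q ^+ n <= K * q ^+ 2 * (1 / 2) ^+ n.
    apply: ler_wpM2l; first by rewrite mulr_ge0 ?exprn_ge0.
    by apply: lerXn2r; rewrite // nnegrE.
  have -> : K * q ^+ n.+2 = K * q ^+ 2 * q ^+ n by rewrite -mulrA -exprD.
  have -> : (1 / 2 : R) ^+ n.+1 = (1 / 2) ^+ n / 2 by rewrite exprS mulrC div1r.
  lra.
rewrite leNgt; apply/negP => lt.
pose d := normc (L - c 0%N - e * c 1%N) - 2 * K * q ^+ 2.
have d0 : 0 < d by rewrite subr_gt0.
have [N _ NP] := eL d d0.
have := NP N.+2 _; rewrite /= => /(_ (leq_trans (leqnSn _) (leqnSn _))).
have := part N.
set S := \sum_(k < N.+2) _.
have -> : S - L = (S - c 0%N - e * c 1%N) - (L - c 0%N - e * c 1%N).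
  by rewrite !opprD !opprK; ring.
have := ler_distc (L - c 0%N - e * c 1%N) (S - c 0%N - e * c 1%N).
rewrite (normcB (L - _ - _) (S - _ - _)) => h1 h2 h3.
have : 2 * K * q ^+ 2 * (1 - (1 / 2) ^+ N) <= 2 * K * q ^+ 2.
  apply: ler_piMr; first by rewrite mulr_ge0 ?exprn_ge0// mulr_ge0.
  by rewrite lerBlDr lerDl exprn_ge0.
rewrite /d in h3; lra.
Qed.

(** * Derivatives and exponentials of complex functions of a real variable *)

Section complex_derivative.
Variable R : realType.
Implicit Types (y z : R -> R[i]) (t : R) (a c : R[i]).

Lemma Re_mulc a c : complex.Re (a * c) =
  complex.Re a * complex.Re c - complex.Im a * complex.Im c.
Proof. by case: a; case: c. Qed.

Lemma Im_mulc a c : complex.Im (a * c) =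
  complex.Re a * complex.Im c + complex.Im a * complex.Re c.
Proof. by case: a; case: c. Qed.

Lemma Re_addc a c : complex.Re (a + c) = complex.Re a + complex.Re c.
Proof. by case: a; case: c. Qed.

Lemma Im_addc a c : complex.Im (a + c) = complex.Im a + complex.Im c.
Proof. by case: a; case: c. Qed.

Lemma is_cderive_cst c t : is_cderive (fun=> c) t 0.
Proof. by split; exact: is_derive_cst. Qed.

Lemma is_cderiveD y z t a c : is_cderive y t a -> is_cderive z t c ->
  is_cderive (fun u => y u + z u) t (a + c).
Proof.
move=> [y1 y2] [z1 z2]; split; rewrite ?Re_addc ?Im_addc.
  have -> : (fun u => complex.Re (y u + z u)) =
      (fun u => complex.Re (y u)) + (fun u => complex.Re (z u)).
    by apply/funext => u; rewrite Re_addc.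
  exact: is_deriveD.
have -> : (fun u => complex.Im (y u + z u)) =
    (fun u => complex.Im (y u)) + (fun u => complex.Im (z u)).
  by apply/funext => u; rewrite Im_addc.
exact: is_deriveD.
Qed.

Lemma is_cderiveM y z t a c : is_cderive y t a -> is_cderive z t c ->
  is_cderive (fun u => y u * z u) t (a * z t + y t * c).
Proof.
move=> [y1 y2] [z1 z2]; split.
  have -> : (fun u => complex.Re (y u * z u)) =
      (fun u => complex.Re (y u)) * (fun u => complex.Re (z u)) -
      (fun u => complex.Im (y u)) * (fun u => complex.Im (z u)).
    by apply/funext => u; rewrite Re_mulc.
  apply: (is_derive_eq (is_deriveB (is_deriveM y1 z1) (is_deriveM y2 z2))).
  by rewrite Re_addc !Re_mulc /GRing.scale /=; ring.
have -> : (fun u => complex.Im (y u * z u)) =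
    (fun u => complex.Re (y u)) * (fun u => complex.Im (z u)) +
    (fun u => complex.Im (y u)) * (fun u => complex.Re (z u)).
  by apply/funext => u; rewrite Im_mulc.
apply: (is_derive_eq (is_deriveD (is_deriveM y1 z2) (is_deriveM y2 z1))).
by rewrite Im_addc !Im_mulc /GRing.scale /=; ring.
Qed.

Lemma is_cderive_eq y t a c : is_cderive y t a -> a = c -> is_cderive y t c.
Proof. by move=> ya <-. Qed.

Lemma is_cderiveZ y t a c : is_cderive y t a -> is_cderive (fun u => c * y u) t (c * a).
Proof.
move=> ya; apply: is_cderive_eq (is_cderiveM (is_cderive_cst c t) ya) _.
by rewrite mul0r add0r.
Qed.

Lemma is_cderiveB y z t a c : is_cderive y t a -> is_cderive z t c ->
  is_cderive (fun u => y u - z u) t (a - c).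
Proof.
move=> ya /(is_cderiveZ (-1)) zc; have := is_cderiveD ya zc.
by rewrite mulN1r; under eq_fun do rewrite mulN1r.
Qed.

Lemma cderive_continuous y t a : is_cderive y t a ->
  {for t, continuous (fun u => complex.Re (y u))} /\
  {for t, continuous (fun u => complex.Im (y u))}.
Proof.
by move=> [[y1 _] [y2 _]]; split;
  apply: differentiable_continuous; exact/derivable1_diffP.
Qed.

Lemma real_mean_value (f df : R -> R) (T C : R) :
  (forall x, 0 <= x <= T -> is_derive x 1 f (df x)) ->
  (forall x, 0 <= x <= T -> `|df x| <= C) ->
  forall t, 0 <= t <= T -> `|f t - f 0| <= C * t.
Proof.
move=> fd dfC t /andP[t0 tT].
have [||c] := @MVT_segment R f df 0 t t0.
- move=> x; rewrite in_itv/= => /andP[x0 xt]; apply: fd.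
  by rewrite (ltW x0) (le_trans (ltW xt)).
- apply: derivable_within_continuous => x; rewrite in_itv/= => /andP[x0 xt].
  by have [] := fd x; rewrite ?x0 ?(le_trans xt).
rewrite in_itv/= subr0 => /andP[c0 ct] ->.
rewrite normrM (ger0_norm t0) ler_wpM2r// dfC// c0/=.
exact: le_trans ct tT.
Qed.

(** The mean value theorem is applied to real and imaginary parts separately, since no common
    intermediate point exists in general; adding the two estimates costs the factor 2. *)
Lemma complex_mean_value y (dy : R -> R[i]) (T C : R) :
  (forall x, 0 <= x <= T -> is_cderive y x (dy x)) ->
  (forall x, 0 <= x <= T -> normc (dy x) <= C) ->
  forall t, 0 <= t <= T -> normc (y t - y 0) <= 2 * C * t.
Proof.
move=> yd dyC t tT; rewrite (le_trans (ler_normc_ReIm _))//.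
have -> : 2 * C * t = C * t + C * t by ring.
rewrite lerD//.
  have -> : complex.Re (y t - y 0) = complex.Re (y t) - complex.Re (y 0).
    by case: (y t); case: (y 0).
  apply: (@real_mean_value (fun u => complex.Re (y u)) (fun u => complex.Re (dy u)) T) => // x xT.
    by have [] := yd x xT.
  by rewrite (le_trans (ler_Re_normc _))// dyC.
have -> : complex.Im (y t - y 0) = complex.Im (y t) - complex.Im (y 0).
  by case: (y t); case: (y 0).
apply: (@real_mean_value (fun u => complex.Im (y u)) (fun u => complex.Im (dy u)) T) => // x xT.
  by have [] := yd x xT.
by rewrite (le_trans (ler_Im_normc _))// dyC.
Qed.

Lemma real_bounded_itv (f : R -> R) (T : R) :
  {in `[0, T], forall x, {for x, continuous f}} ->
  exists C, forall x, 0 <= x <= T -> `|f x| <= C.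
Proof.
move=> fc; have [T0|T0] := leP 0 T; last first.
  by exists 0 => x /andP[x0 /(le_trans x0)]; rewrite leNgt T0.
have [|c _ cP] := @EVT_max R (fun x => `|f x|) 0 T T0.
  apply: continuous_in_subspaceT => x /[1!inE] xT.
  apply: continuous_comp; last exact: norm_continuous.
  exact: fc.
by exists `|f c| => x xT; apply: cP; rewrite in_itv.
Qed.

Lemma complex_bounded_itv y (T : R) :
  {in `[0, T], forall x, {for x, continuous (fun u => complex.Re (y u))} /\
    {for x, continuous (fun u => complex.Im (y u))}} ->
  exists2 C, 0 <= C & forall x, 0 <= x <= T -> normc (y x) <= C.
Proof.
move=> yc.
have [|C1 C1P] := @real_bounded_itv (fun u => complex.Re (y u)) T.
  by move=> x /yc[].
have [|C2 C2P] := @real_bounded_itv (fun u => complex.Im (y u)) T.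
  by move=> x /yc[].
exists (`|C1| + `|C2|); first by rewrite addr_ge0.
move=> x xT; rewrite (le_trans (ler_normc_ReIm _))// lerD//.
  by rewrite (le_trans (C1P x xT))// ler_norm.
by rewrite (le_trans (C2P x xT))// ler_norm.
Qed.

(** The complex exponential exp(a t) in polar form, so that its addition law and derivative reduce
    to those of [expR], [cos] and [sin]. *)
Definition cexp a t : R[i] := (expR (complex.Re a * t))%:C * expi (complex.Im a * t).

Lemma cexp0 a : cexp a 0 = 1.
Proof. by rewrite /cexp /expi !mulr0 expR0 cos0 sin0 mul1r. Qed.

Lemma cexpD a c t : cexp (a + c) t = cexp a t * cexp c t.
Proof.
rewrite /cexp /expi Re_addc Im_addc !mulrDl expRD cosD sinD.
move: (expR _) (expR _) (cos _) (cos _) (sin _) (sin _) => x y p q u v.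
by apply/eqP; rewrite eq_complex /=; apply/andP; split; apply/eqP; ring.
Qed.

Lemma is_derive_lin (k x : R) : is_derive x 1 (fun u : R => k * u) k.
Proof.
have := is_deriveZ k (is_derive_id x (1 : R)).
by rewrite /GRing.scale /= mulr1.
Qed.

Lemma is_cderive_cexp a t : is_cderive (cexp a) t (a * cexp a t).
Proof.
set al := complex.Re a; set be := complex.Im a.
have dl := is_derive_lin al t; have db := is_derive_lin be t.
have de : is_derive t 1 (fun u => expR (al * u)) (expR (al * t) * al).
  exact: (is_derive1_comp (g := fun u => al * u)).
have dc : is_derive t 1 (fun u => cos (be * u)) (- sin (be * t) * be).
  exact: (is_derive1_comp (g := fun u => be * u)).
have ds : is_derive t 1 (fun u => sin (be * u)) (cos (be * t) * be).
  exact: (is_derive1_comp (g := fun u => be * u)).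
split.
  have -> : (fun u => complex.Re (cexp a u)) =
      (fun u => expR (al * u)) * (fun u => cos (be * u)).
    by apply/funext => u; rewrite /cexp Re_mulc /= mul0r subr0.
  apply: (is_derive_eq (is_deriveM de dc)).
  by rewrite Re_mulc /cexp Re_mulc Im_mulc /GRing.scale /= -/al -/be; ring.
have -> : (fun u => complex.Im (cexp a u)) =
    (fun u => expR (al * u)) * (fun u => sin (be * u)).
  by apply/funext => u; rewrite /cexp Im_mulc /= mul0r addr0.
apply: (is_derive_eq (is_deriveM de ds)).
by rewrite Im_mulc /cexp Re_mulc Im_mulc /GRing.scale /= -/al -/be; ring.
Qed.

Lemma cexpN a t : cexp (- a) t * cexp a t = 1.
Proof.
rewrite -cexpD addNr /cexp /expi /= !mul0r expR0 cos0 sin0.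
by rewrite mul1r.
Qed.

Lemma cexp_bounded a (T : R) :
  exists2 C, 0 <= C & forall x, 0 <= x <= T -> normc (cexp a x) <= C.
Proof.
by apply: complex_bounded_itv => x _; exact: cderive_continuous (is_cderive_cexp a x).
Qed.

End complex_derivative.

(** * First-order expansion of the solution of a linear system *)

Lemma cexp_bounded_all (R : realType) N (a : 'I_N -> R[i]) (T : R) :
  exists2 C, 0 <= C & forall x j, 0 <= x <= T ->
    normc (cexp (a j) x) <= C /\ normc (cexp (- a j) x) <= C.
Proof.
have /choice[C1 C1P] : forall j, exists C, 0 <= C /\
    forall x, 0 <= x <= T -> normc (cexp (a j) x) <= C.
  by move=> j; have [C] := cexp_bounded (a j) T; exists C.
have /choice[C2 C2P] : forall j, exists C, 0 <= C /\
    forall x, 0 <= x <= T -> normc (cexp (- a j) x) <= C.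
  by move=> j; have [C] := cexp_bounded (- a j) T; exists C.
have pos j : 0 <= C1 j + C2 j by rewrite addr_ge0//; [have [] := C1P j|have [] := C2P j].
exists (\sum_j (C1 j + C2 j)); first by apply: sumr_ge0 => j _.
move=> x j xT; have le : C1 j + C2 j <= \sum_j (C1 j + C2 j).
  by rewrite (bigD1 j)//= lerDl sumr_ge0.
have [c1 /(_ x xT) h1] := C1P j; have [c2 /(_ x xT) h2] := C2P j.
by split; apply: le_trans le; lra.
Qed.

(* The sup of the entries of exp(-tD) Y(t) is at most 1 plus half of itself, which
   replaces Gronwall's inequality. *)
Lemma duhamel (R : realType) N (a : 'I_N -> R[i]) (T K : R) : 0 <= T -> 0 <= K ->
  exists C e0 : R, 0 < e0 /\
  forall (e : R[i]) (B B1 Y : R -> 'M[R[i]]_N), normc e <= e0 ->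
    Y 0 = 1%:M ->
    (forall x i j, 0 <= x <= T -> is_cderive (fun u => Y u i j) x ((B x *m Y x) i j)) ->
    (forall x i j, 0 <= x <= T -> normc (B1 x i j) <= K) ->
    (forall x i j, 0 <= x <= T ->
       normc (B x i j - a i *+ (i == j) - e * B1 x i j) <= K * normc e ^+ 2) ->
    forall l k (H : R -> R[i]), H 0 = 0 ->
      (forall x, 0 <= x <= T ->
         is_cderive H x (cexp (- a l) x * B1 x l k * cexp (a k) x)) ->
      normc (cexp (- a l) T * Y T l k - (l == k)%:R - e * H T) <= C * normc e ^+ 2.
Proof.
move=> T0 K0; have [C1 C10 C1P] := cexp_bounded_all a T.
(* [C1] bounds the exponentials and 2 K |e| the perturbation, so G |e| bounds the kernel [g] below.
   In [Q], the first term is the second-order part of [B] against |W| <= 2, the second the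
   first-order part against |W - Id| <= 4 n G T |e|. *)
pose G := C1 * (2 * K) * C1; pose n : R := N%:R.
have n0 : 0 <= n by rewrite ler0n.
have G0 : 0 <= G by rewrite !mulr_ge0.
have nGT : 0 <= n * G * T by rewrite !mulr_ge0.
pose Q := n * (C1 * K * C1 * 2) + n * (C1 * K * C1 * (4 * (n * G * T))).
exists (2 * Q * T), (Num.min 1 (1 / (4 * (n * G * T) + 1))); split.
  by rewrite lt_min ltr01 divr_gt0// ltr_wpDl// mulr_ge0.
move=> e B B1 Y; rewrite le_min => /andP[e1 e2] Y0 Yd B1K BK l k H H0 Hd.
have e0 := normc_ge0 e.
(* Removing the unperturbed flow leaves W' = g W with g = O(e), so that [W] stays near the
   identity. *)
pose W i j x := cexp (- a i) x * Y x i j.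
pose D x := \matrix_(i, j) (B x i j - a i *+ (i == j)).
pose g i j x := cexp (- a i) x * D x i j * cexp (a j) x.
have Wd i j x : 0 <= x <= T -> is_cderive (W i j) x (\sum_p g i p x * W p j x).
  move=> xT; apply: is_cderive_eq (is_cderiveM (is_cderive_cexp (- a i) x) (Yd x i j xT)) _.
  have -> : \sum_p g i p x * W p j x = cexp (- a i) x * \sum_p D x i p * Y x p j.
    rewrite mulr_sumr; apply: eq_bigr => p _.
    rewrite /g /W -[RHS]mul1r -(cexpN (a p) x); ring.
  have -> : \sum_p D x i p * Y x p j = (B x *m Y x) i j - a i * Y x i j.
    rewrite mxE; under eq_bigr do rewrite mxE mulrBl.
    rewrite sumrB; congr (_ - _); rewrite (bigD1 i)//= eqxx mulr1n big1 ?addr0//.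
    by move=> p /negPf pi; rewrite eq_sym pi mulr0n mul0r.
  by ring.
have WK0 i j : W i j 0 = (i == j)%:R by rewrite /W cexp0 mul1r Y0 mxE.
have Dle x i j : 0 <= x <= T -> normc (D x i j) <= 2 * K * normc e.
  move=> xT; rewrite mxE.
  have -> : B x i j - a i *+ (i == j) = (B x i j - a i *+ (i == j) - e * B1 x i j) + e * B1 x i j.
    by rewrite subrK.
  rewrite (le_trans (ler_normcD _ _))// normcM.
  have h1 := BK x i j xT; have h2 := B1K x i j xT.
  have h3 : normc e * normc (B1 x i j) <= normc e * K by rewrite ler_wpM2l.
  have h4 : K * normc e ^+ 2 <= K * normc e by rewrite ler_wpM2l// expr2 ler_piMr.
  lra.
have sandwich i j x c M : 0 <= x <= T -> normc c <= M ->
    normc (cexp (- a i) x * c * cexp (a j) x) <= C1 * M * C1.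
  move=> xT cM; rewrite (normcM (_ * c)) (normcM _ c).
  have [_ h1] := C1P x i xT; have [h2 _] := C1P x j xT.
  apply: ler_pM; rewrite ?mulr_ge0 ?normc_ge0//.
  by apply: ler_pM; rewrite ?normc_ge0.
have gle x i j : 0 <= x <= T -> normc (g i j x) <= G * normc e.
  move=> xT; rewrite (le_trans (sandwich _ _ _ _ _ xT (Dle x i j xT)))//.
  by rewrite /G; have -> : C1 * (2 * K * normc e) * C1 = C1 * (2 * K) * C1 * normc e by ring.
have sumn (F : 'I_N -> R[i]) c : (forall p, normc (F p) <= c) -> normc (\sum_p F p) <= n * c.
  move=> Fc; rewrite (le_trans (ler_normc_sum _ _ _))// (le_trans (ler_sum _ (fun p _ => Fc p)))//.
  by rewrite sumr_const card_ord /n mulr_natl.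
(* A bootstrap, used twice: with M the supremum of |W| it yields |W| <= 2, and with M = 2 it yields
   W - Id = O(e). *)
have step M : (forall i j x, 0 <= x <= T -> normc (W i j x) <= M) ->
    forall i j x, 0 <= x <= T -> normc (W i j x - (i == j)%:R) <= 2 * (n * (G * normc e * M)) * T.
  move=> WM i j x xT; rewrite -WK0.
  have M0 : 0 <= M by rewrite (le_trans _ (WM i j x xT))// normc_ge0.
  rewrite (le_trans (complex_mean_value (Wd i j) (C := n * (G * normc e * M)) _ xT))//.
    move=> u uT; apply: sumn => p; rewrite normcM ler_pM ?normc_ge0//; first exact: gle.
    exact: WM.
  apply: ler_wpM2l; last by case/andP: xT.
  by rewrite !mulr_ge0.
(* The bootstrap factor 2 n G T |e| is thus at most 1/2, the half that the supremum argument
   needs. *)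
have small : n * G * T * normc e <= 1 / 4.
  move: e2; rewrite ler_pdivlMr ?ltr_wpDl ?mulr_ge0// => e2.
  have -> : n * G * T * normc e = normc e * (4 * (n * G * T) + 1) / 4 - normc e / 4 by field.
  lra.
have W2 i j x : 0 <= x <= T -> normc (W i j x) <= 2.
  move=> xT; pose S := [set v : R | exists i j x, 0 <= x <= T /\ v = normc (W i j x)].
  have Sn : S !=set0 by exists (normc (W i j x)); exists i, j, x.
  have Sb : has_sup S.
    split=> //.
    have /choice[m mP] : forall ij : 'I_N * 'I_N, exists C, forall x, 0 <= x <= T ->
        normc (W ij.1 ij.2 x) <= C.
      move=> ij; have [|C _ CP] := @complex_bounded_itv R (W ij.1 ij.2) T; last by exists C.
      by move=> u /[!in_itv]/= uT; exact: cderive_continuous (Wd _ _ _ uT).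
    exists (\sum_ij `|m ij|) => _ [p [q [u [uT ->]]]].
    rewrite (le_trans (mP (p, q) u uT))// (bigD1 (p, q))//=.
    by rewrite (le_trans (ler_norm _))// lerDl sumr_ge0.
  have WM p q u : 0 <= u <= T -> normc (W p q u) <= sup S.
    by move=> uT; apply: sup_upper_bound => //; exists p, q, u.
  have half : sup S <= 1 + sup S / 2.
    apply: ge_sup => // _ [p [q [u [uT ->]]]].
    have -> : W p q u = (W p q u - (p == q)%:R) + (p == q)%:R by rewrite subrK.
    rewrite (le_trans (ler_normcD _ _))// addrC lerD//.
      by case: (p == q); rewrite ?normc1// normc0.
    rewrite (le_trans (step _ WM p q u uT))//.
    have s0 : 0 <= sup S by rewrite (le_trans _ (WM p q u uT))// normc_ge0.
    have -> : 2 * (n * (G * normc e * sup S)) * T = 2 * (n * G * T * normc e) * sup S by ring.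
    by rewrite [leRHS]mulrC ler_wpM2r//; lra.
  rewrite (le_trans (WM i j x xT))//; lra.
have W1 i j x : 0 <= x <= T -> normc (W i j x - (i == j)%:R) <= 4 * (n * G * T) * normc e.
  move=> xT; rewrite (le_trans (step 2 W2 i j x xT))//.
  by have -> : 2 * (n * (G * normc e * 2)) * T = 4 * (n * G * T) * normc e by ring.
(* [H] is the first-order term of [W] in integrated form; after its subtraction the derivative is
   O(e^2). *)
pose V x := W l k x - e * H x.
have Vd x : 0 <= x <= T -> is_cderive V x
   (\sum_p g l p x * W p k x - e * (cexp (- a l) x * B1 x l k * cexp (a k) x)).
  by move=> xT; apply: is_cderiveB; [exact: Wd|apply: is_cderiveZ; exact: Hd].
have Vle x : 0 <= x <= T -> normc (\sum_p g l p x * W p k x -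
    e * (cexp (- a l) x * B1 x l k * cexp (a k) x)) <= Q * normc e ^+ 2.
  move=> xT.
  have -> : \sum_p g l p x * W p k x - e * (cexp (- a l) x * B1 x l k * cexp (a k) x) =
     \sum_p (cexp (- a l) x * (D x l p - e * B1 x l p) * cexp (a p) x) * W p k x +
     e * \sum_p (cexp (- a l) x * B1 x l p * cexp (a p) x) * (W p k x - (p == k)%:R).
    have -> : cexp (- a l) x * B1 x l k * cexp (a k) x =
       \sum_p (cexp (- a l) x * B1 x l p * cexp (a p) x) * (p == k)%:R.
      rewrite (bigD1 k)//= eqxx mulr1 big1 ?addr0// => p /negPf ->.
      by rewrite mulr0.
    rewrite !mulr_sumr -sumrB -big_split /=; apply: eq_bigr => p _.
    by rewrite /g; ring.
  rewrite (le_trans (ler_normcD _ _))//.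
  rewrite /Q mulrDl lerD//.
    have -> : n * (C1 * K * C1 * 2) * normc e ^+ 2 = n * (C1 * (K * normc e ^+ 2) * C1 * 2) by ring.
    apply: sumn => p; rewrite normcM ler_pM ?normc_ge0 ?W2//.
    by apply: sandwich => //; rewrite mxE; exact: BK.
  rewrite normcM.
  have -> : n * (C1 * K * C1 * (4 * (n * G * T))) * normc e ^+ 2 =
     normc e * (n * (C1 * K * C1 * (4 * (n * G * T) * normc e))) by ring.
  rewrite ler_wpM2l//; apply: sumn => p; rewrite normcM ler_pM ?normc_ge0 ?W1//.
  by apply: sandwich => //; exact: B1K.
have TT : 0 <= T <= T by rewrite T0 lexx.
have := complex_mean_value Vd Vle TT.
rewrite /V H0 mulr0 subr0 WK0 addrAC /W.
by have -> : 2 * (Q * normc e ^+ 2) * T = 2 * Q * T * normc e ^+ 2 by ring.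
Qed.

(** * The matrix exponential as a fundamental solution *)

Lemma clim_unique (R : realType) (T : Type) (F : set_system T) {FF : ProperFilter F}
    (g : T -> R[i]) a b : clim F g a -> clim F g b -> a = b.
Proof.
move=> ga gb; apply/eqP; rewrite -subr_eq0 -normc_eq0 eq_le normc_ge0 andbT.
rewrite leNgt; apply/negP => ab.
have e0 : 0 < normc (a - b) / 2 by rewrite divr_gt0.
have [x [xa xb]] := filter_ex (filterI (ga _ e0) (gb _ e0)).
have := ler_normcD (a - g x) (g x - b); rewrite addrA subrK (normcB a (g x)).
move: xa xb => /= xa xb tri.
by have := le_lt_trans tri (ltrD xa xb); rewrite -splitr ltxx.
Qed.

Lemma clim_ReIm (R : realType) (g : nat -> R[i]) (a b : R) :
  (fun n => complex.Re (g n)) @ \oo --> a -> (fun n => complex.Im (g n)) @ \oo --> b ->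
  clim \oo g (a +i* b).
Proof.
move=> ga gb e e0; have e2 : 0 < e / 2 by rewrite divr_gt0.
move/cvgrPdist_lt: ga => /(_ _ e2) ga; move/cvgrPdist_lt: gb => /(_ _ e2) gb.
apply: filterS2 ga gb => n; rewrite distrC => h1; rewrite distrC => h2.
rewrite (le_lt_trans (ler_normc_ReIm _))//.
have -> : complex.Re (g n - (a +i* b)) = complex.Re (g n) - a by case: (g n).
have -> : complex.Im (g n - (a +i* b)) = complex.Im (g n) - b by case: (g n).
by rewrite [e]splitr; exact: ltrD.
Qed.

(** The bound D r^k / k! survives formal differentiation, with D replaced by D r. The series and its
    first two derived series hence converge everywhere, in particular at |x| + 1, beyond the point
    of differentiation. *)
Lemma pseries_derive (R : realType) (c : R^nat) (D r : R) :
  0 <= r -> (forall k, `|c k| <= D * r ^+ k / k`!%:R) ->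
  forall x, [/\ cvgn (pseries c x), cvgn (pseries (pseries_diffs c) x) &
    is_derive x (1 : R) (fun x => limn (pseries c x)) (limn (pseries (pseries_diffs c) x))].
Proof.
move=> r0 cD.
have D0 : 0 <= D.
  by have := cD 0%N; rewrite expr0 fact0 divr1 mulr1; exact: le_trans.
have main (d : R^nat) (E : R) : 0 <= E -> (forall k, `|d k| <= E * r ^+ k / k`!%:R) ->
    forall x, cvgn (pseries d x).
  move=> E0 dE x; apply: normed_cvg.
  apply: (@series_le_cvg _ _ (E *: exp_coeff (r * `|x|))) => [k|k|k|].
  - exact: normr_ge0.
  - by rewrite /GRing.scale/= mulr_ge0// exp_coeff_ge0// mulr_ge0.
  - rewrite /GRing.scale/= normrM normrX /exp_coeff/= exprMn.
    have := ler_wpM2r (exprn_ge0 k (normr_ge0 x)) (dE k).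
    by have -> : E * r ^+ k / k`!%:R * `|x| ^+ k = E * (r ^+ k * `|x| ^+ k / k`!%:R) by ring.
  - by apply: is_cvg_seriesZ; exact: is_cvg_series_exp_coeff.
have dif (d : R^nat) (E : R) : (forall k, `|d k| <= E * r ^+ k / k`!%:R) ->
    (forall k, `|pseries_diffs d k| <= E * r * r ^+ k / k`!%:R).
  move=> dE k; rewrite /pseries_diffs normrM ger0_norm//.
  have := ler_wpM2l (ler0n R k.+1) (dE k.+1).
  rewrite factS natrM exprS.
  have k0 : k.+1%:R != 0 :> R by rewrite pnatr_eq0.
  have f0 : k`!%:R != 0 :> R by rewrite pnatr_eq0 -lt0n fact_gt0.
  move: (k.+1%:R) k0 (k`!%:R) f0 => p p0 q q0.
  by have -> : p * (E * (r * r ^+ k) / (p * q)) = E * r * r ^+ k / q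
    by field; rewrite p0 q0.
have D1 : 0 <= D * r by rewrite mulr_ge0.
have c1 := dif _ _ cD; have c2 := dif _ _ c1.
move=> x; split; [exact: main cD x|exact: main c1 x|].
apply: (@pseries_snd_diffs _ _ (`|x| + 1)).
- exact: main cD _.
- exact: main c1 _.
- by apply: main c2 _; rewrite mulr_ge0.
- by rewrite [ltRHS]ger0_norm ?addr_ge0// ltrDl.
Qed.

(** As t is real, the real and imaginary parts of the series are the real series of the parts of its
    coefficients. *)
Lemma cpseries_derive (R : realType) (c : nat -> R[i]) (D r : R) :
  0 <= r -> (forall k, normc (c k) <= D * r ^+ k / k`!%:R) ->
  exists S S' : R -> R[i], [/\
    forall t, clim \oo (fun n => \sum_(k < n) t%:C ^+ k * c k) (S t),
    forall t, clim \oo (fun n => \sum_(k < n) t%:C ^+ k * (k.+1%:R * c k.+1)) (S' t) &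
    forall t, is_cderive S t (S' t)].
Proof.
move=> r0 cD.
have Rec k : `|complex.Re (c k)| <= D * r ^+ k / k`!%:R.
  exact: le_trans (ler_Re_normc _) (cD k).
have Imc k : `|complex.Im (c k)| <= D * r ^+ k / k`!%:R.
  exact: le_trans (ler_Im_normc _) (cD k).
have hR := pseries_derive r0 Rec; have hI := pseries_derive r0 Imc.
pose cR k := complex.Re (c k); pose cI k := complex.Im (c k).
have sumE (d : nat -> R[i]) (t : R) n :
    \sum_(k < n) t%:C ^+ k * d k =
    (pseries (fun k => complex.Re (d k)) t n) +i* (pseries (fun k => complex.Im (d k)) t n).
  rewrite /pseries /series /= !big_mkord.
  elim: n => [|n IH]; first by rewrite !big_ord0.
  rewrite !big_ord_recr /= IH -rmorphXn /=.
  by apply/eqP; rewrite eq_complex /= Re_addc Im_addc Re_mulc Im_mulc /=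
    !mul0r subr0 addr0 !(mulrC (t ^+ n)) !eqxx.
have difR : (fun k => complex.Re (k.+1%:R * c k.+1)) = pseries_diffs cR.
  apply/funext => k; rewrite /pseries_diffs /cR -(rmorph_nat (real_complex R)) Re_mulc /=.
  by rewrite mul0r subr0.
have difI : (fun k => complex.Im (k.+1%:R * c k.+1)) = pseries_diffs cI.
  apply/funext => k; rewrite /pseries_diffs /cI -(rmorph_nat (real_complex R)) Im_mulc /=.
  by rewrite mul0r addr0.
exists (fun t => limn (pseries cR t) +i* limn (pseries cI t)).
exists (fun t => limn (pseries (pseries_diffs cR) t) +i* limn (pseries (pseries_diffs cI) t)).
split=> t.
- have -> : (fun n => \sum_(k < n) t%:C ^+ k * c k) =
      fun n => pseries cR t n +i* pseries cI t n by apply/funext => n; exact: sumE.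
  by apply: clim_ReIm => /=; [have [] := hR t|have [] := hI t].
- have -> : (fun n => \sum_(k < n) t%:C ^+ k * (k.+1%:R * c k.+1)) =
      fun n => pseries (pseries_diffs cR) t n +i* pseries (pseries_diffs cI) t n.
    by apply/funext => n; rewrite -difR -difI; exact: (sumE (fun k => k.+1%:R * c k.+1)).
  by apply: clim_ReIm => /=; [have [] := hR t|have [] := hI t].
- by split; [have [] := hR t|have [] := hI t].
Qed.

Lemma expr_mx_entry (R : rcfType) N (M : 'M[R[i]]_N) k i j :
  normc ((M ^+ k) i j) <= mxn M ^+ k.
Proof.
elim: k i j => [|k IH] i j.
  by rewrite !expr0 mxE; case: (i == j); rewrite ?normc1// normc0.
rewrite !exprS mxE (le_trans (ler_normc_sum _ _ _))//.
rewrite (@le_trans _ _ (\sum_l normc (M i l) * mxn M ^+ k))//.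
  by apply: ler_sum => l _; rewrite normcM ler_wpM2l ?normc_ge0.
by rewrite -mulr_suml ler_wpM2r ?exprn_ge0 ?mxn_ge0// ler_row_mxn.
Qed.

Lemma expr_scalemx (K : comPzRingType) N (a : K) (M : 'M[K]_N) k :
  (a *: M) ^+ k = a ^+ k *: M ^+ k.
Proof.
elim: k => [|k IH]; first by rewrite !expr0 scale1r.
by rewrite !exprS IH -!mulmxE -scalemxAl -scalemxAr scalerA.
Qed.

(** Each entry of exp(t M) is a power series in t whose coefficients are at most |M|^k / k! in norm,
    so termwise differentiation applies. This puts y' = F(e) y under the same Duhamel estimate as
    the original system. *)
Lemma expmx_fundamental (R : realType) N (M : 'M[R[i]]_N) :
  fundamental_solution (fun=> M) (fun t => expmx (t%:C *: M)).
Proof.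
pose c i j k : R[i] := (k`!%:R)^-1 * (M ^+ k) i j.
have cle i j k : normc (c i j k) <= 1 * mxn M ^+ k / k`!%:R.
  rewrite mul1r mulrC /c normcM normcV -(rmorph_nat (real_complex R)) normc_real.
  by rewrite normr_nat ler_wpM2l ?invr_ge0// expr_mx_entry.
have /choice[S SP] : forall ij : 'I_N * 'I_N, exists S : (R -> R[i]) * (R -> R[i]), [/\
    forall t, clim \oo (fun n => \sum_(k < n) t%:C ^+ k * c ij.1 ij.2 k) (S.1 t),
    forall t, clim \oo (fun n => \sum_(k < n) t%:C ^+ k * (k.+1%:R * c ij.1 ij.2 k.+1)) (S.2 t) &
    forall t, is_cderive S.1 t (S.2 t)].
  move=> ij; have [S [S' SS']] := cpseries_derive (mxn_ge0 M) (cle ij.1 ij.2).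
  by exists (S, S').
have expE t : expmx (t%:C *: M) = \matrix_(i, j) (S (i, j)).1 t.
  have cv : series (fun k => (k`!%:R : R[i])^-1 *: (t%:C *: M) ^+ k) @ \oo -->
      (\matrix_(i, j) (S (i, j)).1 t : 'M[R[i]]_N).
    apply/mx_cvg_clim => i j; rewrite mxE; have [h _ _] := SP (i, j).
    apply: clim_near (h t); near=> n.
    rewrite /series /= big_mkord summxE; apply: eq_bigr => k _.
    rewrite mxE expr_scalemx mxE /c /=; ring.
  apply/matrixP => i j; rewrite /expmx.
  have /mx_cvg_clim/(_ i j) l1 := cvgP _ cv.
  have /mx_cvg_clim/(_ i j) l2 := cv.
  exact: clim_unique l1 l2.
split.
  apply/matrixP => i j; rewrite expE mxE mxE; have [h _ _] := SP (i, j).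
  apply: (clim_unique (h 0)); apply: (@clim_near _ _ _ _ (fun=> (i == j)%:R)); last exact: clim_cst.
  exists 1%N => // n /= n1; case: n n1 => // n _.
  rewrite big_ord_recl /= expr0 mul1r big1 ?addr0; last first.
    by move=> k _; rewrite -[0%:C]/(0 : R[i]) expr0n mul0r.
  by rewrite /c fact0 expr0 mxE invr1 mul1r.
move=> t i j; have [_ h2 h3] := SP (i, j).
have -> : (fun u => expmx (u%:C *: M) i j) = (S (i, j)).1.
  by apply/funext => u; rewrite expE mxE.
apply: is_cderive_eq (h3 t) _; apply: (clim_unique (h2 t)).
rewrite expE mxE.
(* The derived coefficients satisfy (k + 1) c_(k+1) = M c_k, from (k + 1) / (k + 1)! = 1 / k! and
   M^(k+1) = M M^k. *)
apply: (@clim_near _ _ _ _ (fun n => \sum_l M i l * \sum_(k < n) t%:C ^+ k * c l j k)); last first.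
  apply: clim_sum => l _; apply: climM; first exact: clim_cst.
  by rewrite mxE; have [h _ _] := SP (l, j); exact: h.
near=> n; under eq_bigr do rewrite mulr_sumr.
rewrite exchange_big /=; apply: eq_bigr => k _.
rewrite /c exprS mxE factS natrM invfM.
have -> : k.+1%:R * (k.+1%:R^-1 / k`!%:R * (\sum_j0 M i j0 * (M ^+ k) j0 j)) =
  (k`!%:R)^-1 * (\sum_j0 M i j0 * (M ^+ k) j0 j).
  by rewrite !mulrA divff ?mul1r// pnatr_eq0.
by rewrite !mulr_sumr; apply: eq_bigr => l _; ring.
Unshelve. all: by end_near. Qed.

(** * Antiderivatives, periodicity of exponentials and bounds on series terms *)

Section complex_integration.
Variable R : realType.
Implicit Types T t : R.

Lemma clim_continuous_Re (g : R -> R[i]) t : clim (nbhs t) g (g t) ->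
  {for t, continuous (fun u => complex.Re (g u))} /\
  {for t, continuous (fun u => complex.Im (g u))}.
Proof.
move=> gt; split; apply/cvgrPdist_lt => e e0; apply: filterS (gt e e0) => u /=;
  apply: le_lt_trans; rewrite distrC.
  have -> : complex.Re (g u) - complex.Re (g t) = complex.Re (g u - g t).
    by case: (g u); case: (g t).
  exact: ler_Re_normc.
have -> : complex.Im (g u) - complex.Im (g t) = complex.Im (g u - g t).
  by case: (g u); case: (g t).
exact: ler_Im_normc.
Qed.

Lemma antiderivative (g : R -> R) T : 0 < T -> continuous g ->
  exists H : R -> R, [/\ H 0 = 0, forall x, 0 <= x <= T -> is_derive x 1 H (g x) &
    (\int[lebesgue_measure]_(x in `[0, T]) g x)%R = H T].
Proof.
move=> T0 gc.
(* Integration starts at -1, and integrability is taken up to T + 1, so that 0 and T are interior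
   points and the derivatives there are two-sided. *)
pose H0 x := (\int[lebesgue_measure]_(t in [set` `[-1, x]]) g t)%R.
have gi : lebesgue_measure.-integrable `[-1, T + 1] (EFin \o g).
  apply: continuous_compact_integrable; first exact: segment_compact.
  exact: continuous_subspaceT.
have H0d x : 0 <= x <= T -> is_derive x 1 H0 (g x).
  move=> /andP[x0 xT].
  have [||//|d1 d2] := @continuous_FTC1_closed R g (-1) x (T + 1) _ gi.
  - by rewrite (le_lt_trans xT)// ltrDl.
  - by rewrite (lt_le_trans _ x0)// ltrN10.
  - exact: gc.
  by apply: DeriveDef; [exact: d1|rewrite -derive1E; exact: d2].
have Hd x : 0 <= x <= T -> is_derive x 1 (fun u => H0 u - H0 0) (g x).
  move=> /H0d xd; have := is_deriveB xd (is_derive_cst (H0 0) x 1).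
  by rewrite subr0.
exists (fun u => H0 u - H0 0); split=> //; first by rewrite subrr.
rewrite /Rintegral (@continuous_FTC2 R g H0 0 T)//.
- exact: continuous_subspaceT.
- have Hc x : 0 <= x <= T -> {for x, continuous H0}.
    move=> /H0d xd; apply: differentiable_continuous; apply/derivable1_diffP.
    by have [] := xd.
  split.
  + move=> x /[!in_itv]/= /andP[x0 xT].
    have xT' : 0 <= x <= T by rewrite !ltW.
    by have [] := H0d x xT'.
  + by apply: cvg_at_right_filter; apply: Hc; rewrite lexx ltW.
  + by apply: cvg_at_left_filter; apply: Hc; rewrite lexx ltW.
- move=> x /[!in_itv]/= /andP[x0 xT].
  have xT' : 0 <= x <= T by rewrite !ltW.
  by rewrite derive1E; have [_ ->] := H0d x xT'.
Qed.

Lemma complex_antiderivative (g : R -> R[i]) T : 0 < T ->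
  (forall t, clim (nbhs t) g (g t)) ->
  exists H : R -> R[i], [/\ H 0 = 0, forall x, 0 <= x <= T -> is_cderive H x (g x) &
    cintegral 0 T g = H T].
Proof.
move=> T0 gc.
have [|H1 [H10 H1d H1T]] := @antiderivative (fun u => complex.Re (g u)) T T0.
  by move=> t; have [] := clim_continuous_Re (gc t).
have [|H2 [H20 H2d H2T]] := @antiderivative (fun u => complex.Im (g u)) T T0.
  by move=> t; have [] := clim_continuous_Re (gc t).
exists (fun u => H1 u +i* H2 u); split.
- by rewrite H10 H20.
- by move=> x xT; split=> /=; [exact: H1d|exact: H2d].
- by rewrite /cintegral H1T H2T.
Qed.

Lemma cexp_clim (a : R[i]) t : clim (nbhs t) (cexp a) (cexp a t).
Proof.
have [c1 c2] := cderive_continuous (is_cderive_cexp a t).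
move=> e e0; have e2 : 0 < e / 2 by rewrite divr_gt0.
move/cvgrPdist_lt: c1 => /(_ _ e2) c1; move/cvgrPdist_lt: c2 => /(_ _ e2) c2.
apply: filterS2 c1 c2 => u; rewrite distrC => h1; rewrite distrC => h2.
rewrite (le_lt_trans (ler_normc_ReIm _))//.
have -> : complex.Re (cexp a u - cexp a t) = complex.Re (cexp a u) - complex.Re (cexp a t).
  by case: (cexp a u); case: (cexp a t).
have -> : complex.Im (cexp a u - cexp a t) = complex.Im (cexp a u) - complex.Im (cexp a t).
  by case: (cexp a u); case: (cexp a t).
by rewrite [e]splitr; exact: ltrD.
Qed.

Lemma cexp_period (n : int) T : 0 < T -> cexp ('i * (angular_freq T)%:C * n%:~R) T = 1.
Proof.
move=> T0; set w := 'i * (angular_freq T)%:C.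
have w1 : cexp w T = 1.
  rewrite /cexp /w /angular_freq /expi Re_mulc Im_mulc /=
    !(mul0r, mulr0, mul1r, subrr, add0r, addr0).
  rewrite oppr0 mul0r expR0 divfK ?gt_eqF// mulr_natl cos2pi sin2pi.
  by rewrite mul1r.
have wn (k : nat) : cexp (w * k%:R) T = 1.
  elim: k => [|k IH]; first by rewrite mulr0 /cexp /expi /= !mul0r expR0 cos0 sin0 mul1r.
  by rewrite -addn1 natrD mulrDr mulr1 cexpD IH w1 mulr1.
case: n => k; first by rewrite -pmulrn wn.
rewrite NegzE mulrNz mulrN -pmulrn.
by have := cexpN (w * k.+1%:R) T; rewrite wn mulr1.
Qed.

(** A term is the difference of two consecutive partial sums, eventually both within 1 of the limit
    uniformly in [d]; the initial terms are bounded one by one. *)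
Lemma series_terms_bounded (D : Type) (z : nat -> D -> R[i]) (L : D -> R[i]) :
  (\forall n \near \oo, forall d, normc (\sum_(k < n) z k d - L d) < 1) ->
  (forall n, exists K, forall d, normc (z n d) <= K) ->
  exists2 K, 0 <= K & forall n d, normc (z n d) <= K.
Proof.
move=> [N _ NP] zK.
apply: (@eventually_bounded R D (fun n d => normc (z n d)) N 2) => // n d Nn.
have h1 := NP n Nn d; have h2 := NP n.+1 (leqW Nn) d.
have -> : z n d = (\sum_(k < n.+1) z k d - L d) - (\sum_(k < n) z k d - L d).
  by rewrite big_ord_recr /=; ring.
rewrite (le_trans (ler_normcD _ _))// normcN; lra.
Qed.

End complex_integration.

(** * Quadratic remainders of the expansions of [F] and [A] *)

Lemma ltcN (R : realType) (z : R[i]) (d : R) : (`|z| < d%:C) = (normc z < d).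
Proof. by rewrite -[`|z|]/((normc z)%:C) ltcR. Qed.

Lemma power_series_entry (R : realType) m n (a : nat -> 'M[R[i]]_(m, n)) e k i j :
  power_series a e k i j = \sum_(p < k) e ^+ p * a p i j.
Proof.
rewrite /power_series /series /= big_mkord summxE.
by apply: eq_bigr => p _; rewrite mxE.
Qed.

(** Convergence at the single point rho inside the disc bounds the terms there, which is a Cauchy
    estimate |F_p| rho^p <= K and feeds [power_series_remainder]. Taking e = 0 in the result
    identifies F 0. *)
Lemma analytic_remainder (R : realType) N (F : R[i] -> 'M[R[i]]_N) (F_ : nat -> 'M[R[i]]_N) :
  analytic_at0 F F_ -> F 0 = F_ 0%N /\
  exists2 K, 0 <= K & \forall e \near nbhs (0 : R[i]),
    mxn (F e - F 0 - e *: F_ 1%N) <= K * normc e ^+ 2.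
Proof.
move=> /nbhs0cP[d d0 dF].
have Fl e i j : normc e < d -> clim \oo (fun n => \sum_(p < n) e ^+ p * F_ p i j) (F e i j).
  move=> /dF /mx_cvg_clim/(_ i j); apply: clim_near; near=> n.
  exact: power_series_entry.
pose rho := d / 2; have rho0 : 0 < rho by rewrite divr_gt0.
have rhod : rho < d by rewrite /rho; lra.
have nrho : normc (rho%:C) = rho by rewrite normc_real gtr0_norm.
have [||K K0 KP] := @series_terms_bounded R ('I_N * 'I_N)%type
    (fun p ij => rho%:C ^+ p * F_ p ij.1 ij.2) (fun ij => F rho%:C ij.1 ij.2).
- by apply: filter_forall => ij; apply: Fl; rewrite ?nrho// ltr01.
- move=> n; exists (\sum_ij normc (rho%:C ^+ n * F_ n ij.1 ij.2)) => ij.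
  by rewrite (bigD1 ij)//= lerDl sumr_ge0// => ? _; exact: normc_ge0.
have KF i j p : normc (F_ p i j) * rho ^+ p <= K.
  by have := KP p (i, j); rewrite normcM normcX nrho mulrC.
have rem e i j : normc e <= rho / 2 ->
    normc (F e i j - F_ 0%N i j - e * F_ 1%N i j) <= 2 * K * (normc e / rho) ^+ 2.
  move=> er; apply: (power_series_remainder rho0 (KF i j) er).
  by apply: Fl; rewrite (le_lt_trans er)//; lra.
have F00 : F 0 = F_ 0%N.
  apply/matrixP => i j; have := rem 0 i j; rewrite normc0 => /(_ _).
  rewrite !mul0r expr0n mulr0 subr0 => h.
  apply/eqP; rewrite -subr_eq0 -normc_eq0 eq_le normc_ge0 andbT h//.
  by rewrite divr_ge0// ltW.
split=> //; exists (\sum_(i < N) \sum_(j < N) 2 * K / rho ^+ 2).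
  by apply: sumr_ge0 => i _; apply: sumr_ge0 => j _; rewrite divr_ge0 ?exprn_ge0 ?mulr_ge0// ltW.
apply/nbhs0cP; exists (rho / 2); first by rewrite divr_gt0.
move=> e er; rewrite /mxn mulr_suml ler_sum// => i _.
rewrite mulr_suml ler_sum// => j _; rewrite !mxE F00.
have := rem e i j (ltW er); rewrite expr_div_n.
by have -> : 2 * K * (normc e ^+ 2 / rho ^+ 2) = 2 * K / rho ^+ 2 * normc e ^+ 2 by ring.
Unshelve. all: by end_near. Qed.

Lemma mx_continuous_clim (R : realType) N (B : R -> 'M[R[i]]_N) : continuous B ->
  forall t i j, clim (nbhs t) (fun u => B u i j) (B t i j).
Proof. by move=> Bc t i j; have /mx_cvg_clim := Bc t; apply. Qed.

Lemma mx_continuous_bounded (R : realType) N (B : R -> 'M[R[i]]_N) (T : R) :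
  continuous B ->
  exists2 K, 0 <= K & forall x i j, 0 <= x <= T -> normc (B x i j) <= K.
Proof.
move=> Bc.
have /choice[m mP] : forall ij : 'I_N * 'I_N, exists C, 0 <= C /\
    forall x, 0 <= x <= T -> normc (B x ij.1 ij.2) <= C.
  move=> ij; have [|C C0 CP] := @complex_bounded_itv R (fun u => B u ij.1 ij.2) T.
    by move=> u _; apply: clim_continuous_Re; exact: mx_continuous_clim.
  by exists C.
exists (\sum_ij m ij); first by apply: sumr_ge0 => ij _; have [] := mP ij.
move=> x i j xT; have [_ /(_ x xT) h] := mP (i, j).
rewrite (le_trans h)// (bigD1 (i, j))//= lerDl sumr_ge0// => ij _.
by have [] := mP ij.
Qed.

(** The Cauchy estimate at rho = r0 / 2 is taken over all entries and all times in [0, T] at once;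
    uniform convergence makes its constant independent of time. The range r0 / 4 is rho / 2. *)
Lemma expansion_remainder (R : realType) N (T r0 : R)
    (A : R[i] -> R -> 'M[R[i]]_N) (A_ : nat -> R -> 'M[R[i]]_N) :
  0 < r0 -> periodic_expansion T r0 A A_ ->
  exists2 K, 0 <= K & forall e x i j, normc e <= r0 / 4 -> 0 <= x <= T ->
    normc (A e x i j - A_ 0%N x i j - e * A_ 1%N x i j) <= K * normc e ^+ 2.
Proof.
move=> r00 [_ Ac Au].
pose rho := r0 / 2; have rho0 : 0 < rho by rewrite divr_gt0.
have rhod : rho < r0 by rewrite /rho; lra.
have nrho : normc (rho%:C) = rho by rewrite normc_real gtr0_norm.
have Al e : normc e < r0 -> forall eps : R, 0 < eps -> \forall n \near \oo, forall t i j,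
    normc (\sum_(p < n) e ^+ p * A_ p t i j - A e t i j) < eps.
  rewrite -ltcN => /Au/mx_uniform_clim h eps eps0.
  have : \forall n \near \oo, forall t i j,
    normc (power_series (A_ ^~ t) e n i j - A e t i j) < eps := h eps eps0.
  apply: filterS => n nP t i j.
  by have := nP t i j; rewrite power_series_entry.
pose D := ({x : R | 0 <= x <= T} * 'I_N * 'I_N)%type.
have [||K K0 KP] := @series_terms_bounded R D
    (fun p d => rho%:C ^+ p * A_ p (sval d.1.1) d.1.2 d.2)
    (fun d => A rho%:C (sval d.1.1) d.1.2 d.2).
- have := Al rho%:C; rewrite nrho => /(_ rhod 1 ltr01).
  by apply: filterS => n nP [[t i] j]; exact: nP.
- move=> n; have [C C0 CP] := mx_continuous_bounded T (Ac n).1.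
  exists (rho ^+ n * C) => -[[[x xT] i] j] /=.
  by rewrite normcM normcX nrho ler_wpM2l ?exprn_ge0 ?(ltW rho0)// CP.
have KF x i j p : 0 <= x <= T -> normc (A_ p x i j) * rho ^+ p <= K.
  by move=> xT; have := KP p (exist _ x xT, i, j); rewrite normcM normcX nrho mulrC.
exists (2 * K / rho ^+ 2); first by rewrite divr_ge0 ?exprn_ge0 ?mulr_ge0// ltW.
move=> e x i j er xT.
have er2 : normc e <= rho / 2 by rewrite (le_trans er)// /rho; lra.
have := power_series_remainder rho0 (fun p => KF x i j p xT) er2; rewrite expr_div_n.
have -> : 2 * K * (normc e ^+ 2 / rho ^+ 2) = 2 * K / rho ^+ 2 * normc e ^+ 2 by ring.
apply=> eps eps0; have er3 : normc e < r0 by rewrite (le_lt_trans er)//; lra.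
by apply: filterS (Al e er3 eps eps0) => n; apply.
Qed.

(** * The first-order Floquet matrix and the eigenvalue expansion *)

Lemma eq_of_small (R : realType) (c : R[i]) (C d : R) : 0 < d ->
  (forall e : R, 0 < e < d -> normc c <= C * e) -> c = 0.
Proof.
move=> d0 cC; apply/eqP; rewrite -normc_eq0 eq_le normc_ge0 andbT leNgt.
apply/negP => c0.
pose e := Num.min (d / 2) (normc c / (2 * (`|C| + 1))).
have C1 : 0 < 2 * (`|C| + 1) by rewrite mulr_gt0// ltr_wpDl.
have e0 : 0 < e by rewrite lt_min !divr_gt0.
have ed : e < d by rewrite (@le_lt_trans _ _ (d / 2))// ?ge_min ?lexx//; lra.
have ec : e * (2 * (`|C| + 1)) <= normc c by rewrite -ler_pdivlMr// ge_min lexx orbT.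
have := cC e; rewrite e0 ed => /(_ isT) h.
have : C * e <= `|C| * e by rewrite ler_wpM2r ?(ltW e0)// ler_norm.
have : 0 <= `|C| * e by rewrite mulr_ge0// ltW.
move: h ec; rewrite !mulrDr mulr1; lra.
Qed.

Lemma floquet_first_order (R : realType) (N : nat) (T r0 : R)
    (A : R[i] -> R -> 'M[R[i]]_N) (A_ : nat -> R -> 'M[R[i]]_N)
    (A0 : 'M[R[i]]_N) (m : 'I_N -> int)
    (X P : R[i] -> R -> 'M[R[i]]_N)
    (F : R[i] -> 'M[R[i]]_N) (F_ : nat -> 'M[R[i]]_N) :
  0 < T -> 0 < r0 -> periodic_expansion T r0 A A_ ->
  (forall t, A_ 0%N t = A0) -> is_diag_mx A0 ->
  (forall e : R[i], `|e| < r0%:C -> fundamental_solution (A e) (X e)) ->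
  (forall e : R[i], `|e| < r0%:C -> floquet_decomposition T (X e) (P e) (F e)) ->
  analytic_at0 F F_ ->
  F 0 = A0 - ('i * (angular_freq T)%:C) *: diag_mx (\row_k (m k)%:~R) ->
  forall l k, F 0 l l = F 0 k k ->
    F_ 1%N l k = fourier_mx T (A_ 1%N) (m l - m k) l k.
Proof.
move=> T0 r00 Aexp A00 A0d Xf PF Fan F0E l k F0lk.
have Tge0 := ltW T0.
have [KA KA0 KAP] := expansion_remainder r00 Aexp.
have [F00 [KF KF0 /nbhs0cP[dF dF0 KFP]]] := analytic_remainder Fan.
have [_ Ac _] := Aexp.
have [K1 K10 K1P] := mx_continuous_bounded T (Ac 1%N).1.
set w := 'i * (angular_freq T)%:C in F0E.
have F0ii i : F 0 i i = A0 i i - w * (m i)%:~R.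
  by rewrite F0E !mxE eqxx mulr1n.
have offd i j : i != j -> A0 i j = 0 by move=> ij; move/is_diag_mxP: A0d; apply.
have F0off i j : i != j -> F 0 i j = 0.
  by move=> ij; rewrite F0E !mxE (negPf ij) mulr0n mulr0 subr0 offd.
pose g x := cexp (- A0 l l) x * A_ 1%N x l k * cexp (A0 k k) x.
have gE x : g x = expi (- (angular_freq T * (m l - m k)%:~R * x)) * A_ 1%N x l k.
  rewrite /g mulrAC -cexpD; congr (_ * _).
  have -> : - A0 l l + A0 k k = - (w * (m l - m k)%:~R).
    have := F0lk; rewrite !F0ii rmorphB mulrBr => h.
    have -> : A0 l l = (A0 k k - w * (m k)%:~R) + w * (m l)%:~R by rewrite -h subrK.
    by rewrite /=; ring.
  have -> : - (w * (m l - m k)%:~R) = 0 +i* (- (angular_freq T * (m l - m k)%:~R)).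
    rewrite /w -(rmorph_int (real_complex R)) -mulrA -rmorphM /=.
    by apply/eqP; rewrite eq_complex /= !(mul0r, mul1r, mulr0, subr0, add0r, addr0, oppr0) !eqxx.
  by rewrite /cexp /= mul0r expR0 mulNr mul1r.
have gc t : clim (nbhs t) g (g t).
  apply: climM; last exact: cexp_clim.
  by apply: climM; [exact: cexp_clim|exact: mx_continuous_clim (Ac 1%N).1 t l k].
have [H [H0 Hd HT]] := complex_antiderivative T0 gc.
have fE : fourier_mx T (A_ 1%N) (m l - m k) l k = (T^-1)%:C * H T.
  by rewrite mxE -HT; congr (_ * cintegral _ _ _); apply/funext => x; rewrite gE.
pose K := K1 + KA.
have [C1 [d1 [d10 D1]]] := @duhamel R N (fun i => A0 i i) T K Tge0 (addr_ge0 K10 KA0).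
pose K' := mxn (F_ 1%N) + KF.
have [C2 [d2 [d20 D2]]] := @duhamel R N (fun i => F 0 i i) T K' Tge0 (addr_ge0 (mxn_ge0 _) KF0).
pose G x : R[i] := F_ 1%N l k * x%:C.
(* The diagonals of [A0] and F 0 differ by integer multiples of i Omega, whose exponentials over a
   full period are 1, so both expansions carry the same prefactor. *)
have cT : cexp (- A0 l l) T = cexp (- F 0 l l) T.
  have -> : - A0 l l = - F 0 l l + - (w * (m l)%:~R) by rewrite F0ii; ring.
  rewrite cexpD.
  have := cexpN (w * (m l)%:~R) T; rewrite cexp_period// mulr1 => ->.
  by rewrite mulr1.
(* The Fourier coefficient is H(T) / T, and G(T) is T times the entry of F_1. *)
suff HG : H T = G T.
  rewrite fE HG /G mulrCA -rmorphM /= mulVf ?gt_eqF//.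
  by rewrite mulr1.
apply/eqP; rewrite -subr_eq0; apply/eqP.
pose d := Num.min (Num.min (r0 / 4) dF) (Num.min d1 d2).
have d0 : 0 < d by rewrite !lt_min dF0 d10 d20 divr_gt0.
apply: (@eq_of_small _ _ (C1 + C2) d d0) => e /andP[e0 ed].
have ne : normc e%:C = e by rewrite normc_real gtr0_norm.
move: ed; rewrite !lt_min => /andP[/andP[er edF] /andP[ed1 ed2]].
have er0 : `|e%:C| < r0%:C by rewrite ltcN ne (lt_trans er)//; lra.
have [X0 Xd] := Xf _ er0; have [Pp P0 XE] := PF _ er0.
(* Periodicity gives P(T) = P(0) = Id, so both systems share their solution matrix at time T. *)
have XT : X e%:C T = expmx (T%:C *: F e%:C).
  by rewrite XE; have := Pp 0; rewrite add0r P0 => ->; rewrite mul1mx.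
have [E0 Ed] := expmx_fundamental (F e%:C).
have h1 : normc (cexp (- A0 l l) T * X e%:C T l k - (l == k)%:R - e%:C * H T) <= C1 * e ^+ 2.
  rewrite -[X in C1 * X ^+ 2]ne.
  apply: (D1 e%:C (A e%:C) (A_ 1%N) (X e%:C)) => //.
  - by rewrite ne ltW.
  - by move=> x i j xT; rewrite (le_trans (K1P x i j xT))// lerDl.
  - move=> x i j xT.
    have -> : A0 i i *+ (i == j) = A_ 0%N x i j.
      by rewrite A00; case: eqVneq => [->|ij]; rewrite ?mulr1n// mulr0n offd.
    rewrite (le_trans (KAP _ x i j _ xT))//; first by rewrite ne ltW.
    by rewrite ler_wpM2r ?exprn_ge0 ?normc_ge0// lerDr.
have h2 : normc (cexp (- F 0 l l) T * X e%:C T l k - (l == k)%:R - e%:C * G T) <= C2 * e ^+ 2.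
  rewrite -[X in C2 * X ^+ 2]ne XT.
  apply: (D2 e%:C (fun=> F e%:C) (fun=> F_ 1%N) (fun t => expmx (t%:C *: F e%:C))) => //.
  - by rewrite ne ltW.
  - by move=> x i j xT; rewrite (le_trans (ler_entry_mxn _ _ _))// lerDl.
  - move=> x i j xT.
    have -> : F 0 i i *+ (i == j) = F 0 i j.
      by case: eqVneq => [->|ij]; rewrite ?mulr1n// mulr0n F0off.
    have -> : F e%:C i j - F 0 i j - e%:C * F_ 1%N i j =
        (F e%:C - F 0 - e%:C *: F_ 1%N) i j by rewrite !mxE.
    rewrite (le_trans (ler_entry_mxn _ _ _))// (le_trans (KFP _ _))//; first by rewrite ne.
    by rewrite ler_wpM2r ?exprn_ge0 ?normc_ge0// lerDr mxn_ge0.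
  - by rewrite /G mulr0.
  - move=> x xT; rewrite -F0lk mulrAC cexpN mul1r.
    rewrite -[X in is_cderive _ _ X]mulr1; apply: is_cderiveZ.
    by split; [exact: is_derive_id|exact: is_derive_cst].
(* Everything but the first-order terms cancels, which leaves e |H(T) - G(T)| <= (C1 + C2) e^2 for
   all small positive e. *)
have eq : e%:C * (H T - G T) =
   (cexp (- F 0 l l) T * X e%:C T l k - (l == k)%:R - e%:C * G T) -
   (cexp (- A0 l l) T * X e%:C T l k - (l == k)%:R - e%:C * H T) by rewrite cT; ring.
rewrite -(ler_pM2l e0) -{1}ne -normcM eq.
rewrite (le_trans (ler_normcD _ _))// normcN.
have -> : e * ((C1 + C2) * e) = C2 * e ^+ 2 + C1 * e ^+ 2 by ring.
exact: lerD.
Qed.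

(** A further diagonal entry equal to [b] would put r + 1 factors X - b into the characteristic
    polynomial. *)
Lemma degenerate_dr_neq (K : fieldType) r s (B : 'M[K]_(r + s)) (b : K) :
  is_diag_mx B -> (forall i, B (lshift s i) (lshift s i) = b) ->
  mup b (char_poly B) = r -> forall j, B (rshift r j) (rshift r j) != b.
Proof.
move=> Bd Bul Bm j; apply/eqP => Bj.
have cp0 : char_poly B != 0 by rewrite monic_neq0 ?char_poly_monic.
have : (r < mup b (char_poly B))%N; last by rewrite Bm ltnn.
rewrite mup_geq// char_poly_trig ?is_diag_mx_is_trig// big_split_ord /=.
rewrite (eq_bigr (fun=> 'X - b%:P)); last by move=> i _; rewrite Bul.
rewrite prodr_const card_ord exprSr dvdp_mul2l ?expf_neq0 ?polyXsubC_eq0//.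
by rewrite (bigD1 j)//= Bj dvdp_mulr.
Qed.

Theorem theorem4p7 (R : realType) (r s : nat) (T r0 : R)
    (A : R[i] -> R -> 'M[R[i]]_(r + s)) (A_ : nat -> R -> 'M[R[i]]_(r + s))
    (A0 : 'M[R[i]]_(r + s)) (m : 'I_(r + s) -> int)
    (X P : R[i] -> R -> 'M[R[i]]_(r + s))
    (F : R[i] -> 'M[R[i]]_(r + s)) (F_ : nat -> 'M[R[i]]_(r + s))
    (f0 : R[i]) (f : 'I_r -> R[i])
    (T_gt0 : 0 < T) (r0_gt0 : 0 < r0)
    (A_expansion : periodic_expansion T r0 A A_)
    (A0_constant : forall t, A_ 0%N t = A0)
    (A0_diagonal : is_diag_mx A0)
    (m_folding : forall k, is_folding_number T (A0 k k) (m k))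
    (X_fundamental : forall e : R[i], `|e| < r0%:C ->
       fundamental_solution (A e) (X e))
    (PF_floquet : forall e : R[i], `|e| < r0%:C ->
       floquet_decomposition T (X e) (P e) (F e))
    (F_analytic : analytic_at0 F F_)
    (F0_choice : F 0 =
       A0 - ('i * (angular_freq T)%:C) *: diag_mx (\row_k (m k)%:~R))
    (f0_degenerate : degenerate_point (F 0) f0 r)
    (f0_indices : forall i : 'I_r, F 0 (lshift s i) (lshift s i) = f0)
    (f_eigenvalues : eigenvalue_list (ulsubmx (F_ 1%N)) f) :
  (forall l k : 'I_r,
     ulsubmx (F_ 1%N) l k =
     fourier_mx T (A_ 1%N) (m (lshift s l) - m (lshift s k))
       (lshift s l) (lshift s k)) /\
  exists lam : R[i] -> 'I_(r + s) -> R[i],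
    [/\ (\forall e \near (0 : R[i]), eigenvalue_list (F e) (lam e)),
        (forall j, lam e j @[e --> (0 : R[i])] --> F 0 j j),
        (forall i : 'I_r,
           (fun e => lam e (lshift s i) - (f0 + e * f i)) =o_ (0 : R[i]) id) &
        (forall i : 'I_r, semisimple_eigenvalue (ulsubmx (F_ 1%N)) (f i) ->
           (fun e => lam e (lshift s i) - (f0 + e * f i))
             =O_ (0 : R[i]) (fun e => e ^+ 2))].
Proof.
have [F00 [K K0 FK]] := analytic_remainder F_analytic.
have F0d : is_diag_mx (F 0).
  rewrite F0_choice; apply/is_diag_mxP => i j ij; rewrite !mxE.
  move/is_diag_mxP: A0_diagonal => -> //.
  by rewrite (negPf (_ : i != j)) ?mulr0n ?mulr0 ?subr0.
split=> [l k|].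
  rewrite mxE mxE (floquet_first_order T_gt0 r0_gt0 A_expansion A0_constant A0_diagonal
    X_fundamental PF_floquet F_analytic F0_choice) //.
  by rewrite !f0_indices.
have [_ f0m] := f0_degenerate.
have F0dr := degenerate_dr_neq F0d f0_indices f0m.
have [lam [lamE laml lamo lamO]] :=
  first_order_eigenvalues FK F0d f0_indices F0dr f_eigenvalues.
exists lam; split.
- by near=> e; exact: lamE.
- by move=> j; exact: (clim_cvgP (F := nbhs (0 : R[i])) _ _).1 (laml j).
(* The tolerance is a positive element of [R[i]], hence real, which reduces the claim to the
   estimate in real norms. *)
- move=> i; apply/eqoP => -[eps eps'].
  rewrite ltcE /= => /andP[/eqP -> eps0].
  have := lamo i eps eps0; apply: filterS => e le.
  rewrite -[`|e|]/((normc e)%:C) -[eps +i* 0]/(eps%:C) -rmorphM.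
  by rewrite -[`|_|]/((normc _)%:C) lecR.
- move=> i /lamO[C CP]; apply/eqOP; exists `|C|%:C.
  split; first by rewrite realE lecR normr_ge0.
  move=> k Ck; apply: filterS CP => e le.
  rewrite (@le_trans _ _ (`|C|%:C * `|e ^+ 2|))//; last first.
    by rewrite ler_wpM2r ?normr_ge0// ltW.
  rewrite normrX -[`|e|]/((normc e)%:C) -[`|_|]/((normc _)%:C) -rmorphXn -rmorphM lecR.
  by rewrite (le_trans le)// ler_wpM2r ?exprn_ge0 ?normc_ge0// ler_norm.
Unshelve. all: by end_near. Qed.
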